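(* Let $H = H(O,\vec p)$ be the standard hereditary order in $\Lambda = M_p(F)$, and let $N_H = \{x\in\Lambda^\ast \mid xHx^{-1} = H\}$. Call $x,x'\in N_H$ equivalent if there exist $g,h\in H^\ast$ with $x' = gxh$. Then for any $x\in N_H$ there exist $d\in\mathbb{Z}$ and $0\le k<l$ such that $x$ is equivalent to the matrix $w^{-d}\varrho^k$.
   Context: $R$ is a complete discrete valuation ring with quotient field $K$, $F$ is a finite-dimensional skew field with center $K$, $O$ is the (unique) maximal $R$-order in $F$ (the integral closure of $R$ in $F$), $I=\mathrm{rad}(O)$, and $w\in I$ is a chosen element with $I = wO = Ow$. For $r\in\mathbb{N}$ and $\vec p=(p_1,\dots,p_r)\in\mathbb{N}^r$ (positive integers) put $p = p_1+\dots+p_r$. The order $H(O,\vec p)\subset M_p(F)$ consists of all block matrices $(x_{ij})_{1\le i,j\le r}$, where the block $x_{ij}$ has size $p_i\times p_j$, with entries in $O$ if $i\ge j$ and entries in $I$ if $i<j$. Let $1\le t\le r$ be minimal such that $t\mid r$ and $\vec p = (p_1,\dots,p_t;p_1,\dots,p_t;\dots;p_1,\dots,p_t)$. Put $q = p_1+\dots+p_t$ and $l = r/t$, so $p=lq$. The matrix $\varrho\in M_p(F)$ is the $l\times l$ block matrix with blocks of size $q\times q$ given by $$\varrho=\begin{pmatrix}0&0&\dots&0&w\mathbf 1_q\\ \mathbf 1_q&0&\dots&0&0\\ 0&\mathbf 1_q&\dots&0&0\\ \vdots&\vdots&\ddots&\vdots&\vdots\\ 0&0&\dots&\mathbf 1_q&0\end{pmatrix}$$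 (for $l=1$, $\varrho = w\mathbf 1_p$). An element of $F$ such as $w^{-d}$ is identified with the corresponding diagonal matrix $w^{-d}\mathbf 1_p$. *)

(* Defs.v *)
From HB Require Import structures.
From mathcomp Require Import all_boot all_order all_algebra all_field.
From mathcomp Require Import boolp classical_sets.

Set Implicit Arguments.
Unset Strict Implicit.
Unset Printing Implicit Defensive.

Import GRing.Theory.
Local Open Scope classical_set_scope.
Local Open Scope ring_scope.

(* Rings that live inside an ambient ring are represented by their carrier
   sets; the ideals of a whole commutative ring are obtained with A = setT. *)

Definition left_ideal (S : nzRingType) (A L : set S) : Prop :=
  [/\ L `<=` A,
      L 0,
      forall x y, L x -> L y -> L (x + y)
    & forall a x, A a -> L x -> L (a * x)].

Definition maximal_left_ideal (S : nzRingType) (A L : set S) : Prop :=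
  [/\ left_ideal A L,
      L <> A
    & forall J, left_ideal A J -> L `<=` J -> J <> A -> J = L].

Definition jacobson_radical (S : nzRingType) (A : set S) : set S :=
  [set x | A x /\ forall L, maximal_left_ideal A L -> L x].

Definition lmul_set (S : nzRingType) (x : S) (A : set S) : set S :=
  [set x * a | a in A].

Definition rmul_set (S : nzRingType) (A : set S) (x : S) : set S :=
  [set a * x | a in A].

Definition principal_ideal (R : idomainType) (a : R) : set R :=
  lmul_set a [set: R].

Definition discrete_valuation_ring (R : idomainType) : Prop :=
  (forall J : set R, left_ideal [set: R] J -> exists a, J = principal_ideal a)
  /\ exists2 M : set R, M <> [set 0] &
       maximal_left_ideal [set: R] M
       /\ forall N, maximal_left_ideal [set: R] N -> N = M.

Definition uniformizer (R : idomainType) (a : R) : Prop :=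
  maximal_left_ideal [set: R] (principal_ideal a).

(* If a generates the maximal ideal m, then a ^+ n generates m^n. *)
Definition adic_cauchy (R : idomainType) (a : R) (u : nat -> R) : Prop :=
  forall n, exists N, forall i j, (N <= i)%N -> (N <= j)%N ->
    principal_ideal (a ^+ n) (u i - u j).

Definition adic_limit (R : idomainType) (a : R) (u : nat -> R) (x : R) : Prop :=
  forall n, exists N, forall i, (N <= i)%N ->
    principal_ideal (a ^+ n) (u i - x).

Definition complete_dvr (R : idomainType) : Prop :=
  discrete_valuation_ring R /\
  forall a : R, uniformizer a ->
    forall u, adic_cauchy a u -> exists x, adic_limit a u x.

Definition skew_field (F : unitRingType) : Prop :=
  forall x : F, x != 0 -> x \is a GRing.unit.

(* A subring that is a finitely generated R-module spanning F over K. *)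
Definition is_order (R : idomainType) (F : falgType {fraction R})
    (O : set F) : Prop :=
  [/\ O 1,
      forall x y, O x -> O y -> O (x - y),
      forall x y, O x -> O y -> O (x * y)
    & exists2 e : seq F, (<<e>> = fullv)%VS &
        O = [set \sum_(i < size e) tofrac (c i) *: e`_i
            | c in [set: 'I_(size e) -> R]]].

Definition maximal_order (R : idomainType) (F : falgType {fraction R})
    (O : set F) : Prop :=
  is_order O /\ forall O' : set F, is_order O' -> O `<=` O' -> O' = O.

(* The unit group of a ring of matrices given by its carrier set. *)
Definition mx_units (F : nzRingType) (n : nat) (A : set 'M[F]_n) :
    set 'M[F]_n :=
  [set x | A x /\ exists y, [/\ A y, x *m y = 1%:M & y *m x = 1%:M]].

Definition normalizer (F : nzRingType) (n : nat) (A : set 'M[F]_n) :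
    set 'M[F]_n :=
  [set x | exists y, [/\ x *m y = 1%:M, y *m x = 1%:M
                       & [set x *m h *m y | h in A] = A]].

Definition normalizer_equiv (F : nzRingType) (n : nat) (A : set 'M[F]_n)
    (x x' : 'M[F]_n) : Prop :=
  [/\ normalizer A x, normalizer A x'
    & exists g h, [/\ mx_units A g, mx_units A h & x' = g *m x *m h]].

Definition standard_hereditary_order (F : nzRingType) (O : set F)
    (r : nat) (p : 'I_r -> nat) : set 'M[F]_(\sum_i p i) :=
  [set x | forall (i j : 'I_r) (a : 'I_(p i)) (b : 'I_(p j)),
     (if (j <= i)%N then O else jacobson_radical O) (submxblock x i j a b)].

Arguments standard_hereditary_order {F} O {r} p.

Definition is_period (r : nat) (p : 'I_r -> nat) (t : nat) : Prop :=
  [/\ (1 <= t <= r)%N, (t %| r)%N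
    & forall i j : 'I_r, i = j %[mod t] -> p i = p j].

Definition minimal_period (r : nat) (p : 'I_r -> nat) (t : nat) : Prop :=
  is_period p t /\ forall t', is_period p t' -> (t <= t')%N.

Definition period_sum (r : nat) (p : 'I_r -> nat) (t : nat) : nat :=
  \sum_(i < r | (i < t)%N) p i.

(* The (i, j) entry of the l x l matrix with w in the upper right corner and
   1 on the subdiagonal. *)
Definition rho_coef (F : nzRingType) (w : F) (l i j : nat) : F :=
  if i == j.+1 then 1
  else if (i == 0)%N && (j == l.-1) then w
  else 0.

(* When n = l * q, row a lies in the block row a %/ q, at position a %% q, and
   likewise for columns; the (i, j) block is rho_coef w l i j times the q x q
   identity matrix. *)
Definition rho (F : nzRingType) (w : F) (l q n : nat) : 'M[F]_n :=
  \matrix_(a < n, b < n)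
    if (a %% q == b %% q)%N then rho_coef w l (a %/ q) (b %/ q) else 0.

(* Main.v *)
(* Lifting idempotents from [O / pi O] to the skew field shows that every nonunit
   of [O] is topologically nilpotent, so [O] is local with radical the set of
   nonunits, and [w] defines a discrete valuation of [F] with valuation ring [O].
   The lattices of columns stable under the hereditary order [H] form a chain
   [L_j] indexed by the integers, [H] consists of the matrices preserving every
   [L_j], and an element [x] of the normalizer permutes the chain, hence
   [x L_j = L_(j + c)] for a constant [c].  Comparing the indices at which the
   chain drops from [L_j] to [L_(j + 1)] with those for [j + c] shows that the
   sequence of block sizes is periodic with period [c], so the minimal period [t]
   divides [c].  As [rho] moves the chain by [t] and [w] moves it by [r], some
   [w ^ e rho ^ k] moves it by [c] too, and it differs from [x] by a matrix which
   preserves the chain together with its inverse, that is, a unit of [H]. *)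

Require Import Defs.
From HB Require Import structures.
From mathcomp Require Import all_boot all_order all_algebra all_field.
From mathcomp Require Import boolp classical_sets.
From mathcomp Require Import zify ring.

Set Implicit Arguments.
Unset Strict Implicit.
Unset Printing Implicit Defensive.

Import Order.TTheory GRing.Theory Num.Theory.
Local Open Scope classical_set_scope.
Local Open Scope ring_scope.

(** * Discrete valuation rings *)

Section DiscreteValuationRing.

Variable R : idomainType.
Implicit Types (a b : R) (J M : set R).

Lemma principal_idealP a b : principal_ideal a b <-> exists c, b = a * c.
Proof.
split=> [[c _ <-]|[c ->]]; first by exists c.
by exists c.
Qed.

Lemma principal_left_ideal a : left_ideal [set: R] (principal_ideal a).
Proof.
split=> //; first by apply/principal_idealP; exists 0; rewrite mulr0.
- move=> x y /principal_idealP[c ->] /principal_idealP[d ->].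
  by apply/principal_idealP; exists (c + d); rewrite mulrDr.
- move=> c x _ /principal_idealP[d ->].
  by apply/principal_idealP; exists (c * d); rewrite mulrCA.
Qed.

Lemma left_ideal_unit J a :
  left_ideal [set: R] J -> J a -> a \is a GRing.unit -> J = [set: R].
Proof.
move=> [_ _ _ JM] Ja Ua; apply/seteqP; split=> // b _.
by rewrite -[b](mulrVK Ua); apply: JM.
Qed.

(** Zorn's lemma on the proper ideals containing [a], a nonunit generating a proper ideal. *)
Lemma nonunit_in_maximal_ideal a : a \isn't a GRing.unit ->
  exists2 M : set R, maximal_left_ideal [set: R] M & M a.
Proof.
move=> Na.
pose P J := (J = set0 \/ (left_ideal [set: R] J /\ J a)) /\ ~ J 1.
have P_ideal J : P J -> J !=set0 -> left_ideal [set: R] J /\ J a.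
  by move=> [[->|//] _] [].
have [|A [PA maxA]] := @Zorn_bigcup _ P.
  move=> C CP Ctot; split; last by case=> X CX; case: (CP X CX).
  case: (pselect (\bigcup_(X in C) X !=set0)); last by move/nonemptyPn; left.
  move=> [b [X CX Xb]].
  have [XI Xa] := P_ideal X (CP _ CX) (ex_intro _ _ Xb).
  right; split; last by exists X.
  split=> //; first by exists X => //; case: XI.
  - move=> x y [Y CY Yx] [Z CZ Zy].
    have [YI _] := P_ideal _ (CP _ CY) (ex_intro _ _ Yx).
    have [ZI _] := P_ideal _ (CP _ CZ) (ex_intro _ _ Zy).
    have [YZ|ZY] := Ctot Y Z CY CZ.
      by exists Z => //; case: ZI => _ _ + _; apply => //; apply: YZ.
    by exists Y => //; case: YI => _ _ + _; apply => //; apply: ZY.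
  - move=> c x _ [Y CY Yx]; exists Y => //.
    have [[_ _ _ YM] _] := P_ideal _ (CP _ CY) (ex_intro _ _ Yx).
    exact: YM.
have PaR : P (principal_ideal a).
  split; first (right; split; first exact: principal_left_ideal).
    by apply/principal_idealP; exists 1; rewrite mulr1.
  move=> /principal_idealP[c /esym ac]; case/negP: Na.
  by apply/unitrPr; exists c.
have [AI Aa] : left_ideal [set: R] A /\ A a.
  apply: P_ideal => //; apply: contrapT => /nonemptyPn A0.
  apply: maxA PaR; rewrite A0; split; first exact: sub0set.
  move=> /(_ a) a0; apply: a0.
  by apply/principal_idealP; exists 1; rewrite mulr1.
exists A => //; split=> //; first by move=> A1; case: PA => _; rewrite A1; apply.
move=> J JI AJ JT; apply/seteqP; split=> //; apply: contrapT => JA.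
apply: (maxA J) => //; split; first by right; split=> //; apply: AJ.
by move=> J1; apply: JT; apply: left_ideal_unit JI J1 (unitr1 _).
Qed.

(** The element is a generator of the unique maximal ideal, which contains every nonunit. *)
Lemma dvr_uniformizer : discrete_valuation_ring R ->
  exists a, [/\ uniformizer a, a != 0, a \isn't a GRing.unit
    & forall b, b \is a GRing.unit \/ exists c, b = a * c].
Proof.
move=> [pid [M M0 [maxM uniqM]]].
have [a defM] : exists a, M = principal_ideal a by apply: pid; case: maxM.
exists a; split.
- by rewrite /uniformizer -defM.
- apply/eqP => a0; apply: M0; rewrite defM a0; apply/seteqP; split=> b.
    by move/principal_idealP=> [c ->]; rewrite mul0r.
  by move=> ->; apply/principal_idealP; exists 0; rewrite mulr0.
- apply/negP => Ua; case: maxM => MI MT _; apply: MT.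
  apply: left_ideal_unit MI _ Ua.
  by rewrite defM; apply/principal_idealP; exists 1; rewrite mulr1.
- move=> b; case: (boolP (b \is a GRing.unit)) => [|Nb]; first by left.
  right; apply/principal_idealP; rewrite -defM.
  by have [N maxN Nb'] := nonunit_in_maximal_ideal Nb; rewrite -(uniqM N).
Qed.

(** The intersection of the ideals generated by powers of [a] is principal, say with generator [g].
    Then [g = a h] with [h] again in the intersection, so [g = g (a c)], and [g] must vanish since
    [a] is not a unit. *)
Lemma dvr_separated a b : discrete_valuation_ring R ->
    a != 0 -> a \isn't a GRing.unit ->
  (forall n, exists c, b = a ^+ n * c) -> b = 0.
Proof.
move=> [pid _] a0 Na bJ; pose J := [set b | forall n, exists c, b = a ^+ n * c].
have JI : left_ideal [set: R] J.
  split=> //; first by move=> n; exists 0; rewrite mulr0.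
  - move=> x y Jx Jy n; have [[c ->] [d ->]] := (Jx n, Jy n).
    by exists (c + d); rewrite mulrDr.
  - by move=> c x _ Jx n; have [d ->] := Jx n; exists (c * d); rewrite mulrCA.
have [g defJ] := pid J JI.
have Jg : J g by rewrite defJ; apply/principal_idealP; exists 1; rewrite mulr1.
have [h gE] := Jg 1%N; rewrite expr1 in gE.
have : J h.
  by move=> n; have [c] := Jg n.+1; rewrite gE exprS -mulrA => /(mulfI a0) ->; exists c.
rewrite defJ => /principal_idealP[c hE].
have g0 : g = 0.
  apply/eqP; move: gE; rewrite hE mulrCA => /eqP.
  rewrite -{1}[g]mulr1 => /eqP g1; apply: contraNT Na => /mulfI/(_ _ _ g1) ac.
  by apply/unitrPr; exists c.
have : J b by [].
by rewrite defJ => /principal_idealP[d ->]; rewrite g0 mul0r.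
Qed.

End DiscreteValuationRing.

(** * Orders in a division algebra over a complete discrete valuation ring *)

Section Order.

Variables (R : idomainType) (F : falgType {fraction R}) (O : set F).
Hypotheses (skewF : skew_field F) (ordO : is_order O).

Lemma order1 : O 1. Proof. by case: ordO. Qed.

Lemma orderB x y : O x -> O y -> O (x - y).
Proof. by case: ordO => _ + _ _; apply. Qed.

Lemma orderM x y : O x -> O y -> O (x * y).
Proof. by case: ordO => _ _ + _; apply. Qed.

Lemma order0 : O 0.
Proof. by rewrite -(subrr 1); apply: orderB; apply: order1. Qed.

Lemma orderN x : O x -> O (- x).
Proof. by rewrite -sub0r; apply: orderB; apply: order0. Qed.

Lemma orderD x y : O x -> O y -> O (x + y).
Proof. by move=> Ox Oy; rewrite -[y]opprK; apply: orderB => //; apply: orderN. Qed.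

Lemma orderX x n : O x -> O (x ^+ n).
Proof.
move=> Ox; elim: n => [|n IH]; first exact: order1.
by rewrite exprS; apply: orderM.
Qed.

Lemma order_nat n : O n%:R.
Proof.
elim: n => [|n IH]; first exact: order0.
by rewrite mulrS; apply: orderD => //; apply: order1.
Qed.

Lemma order_generators : exists n (e : 'I_n -> F),
  (forall z, exists c : 'I_n -> {fraction R}, z = \sum_i c i *: e i) /\
  (forall z, O z <-> exists c : 'I_n -> R, z = \sum_i tofrac (c i) *: e i).
Proof.
case: ordO => _ _ _ [e spane ->]; exists (size e), (fun i => e`_i); split=> z.
  have : z \in <<in_tuple e>>%VS by rewrite spane memvf.
  by move=> /coord_span zE; exists (fun i => coord (in_tuple e) i z).
by split=> [[c _ <-]|[c ->]]; exists c.
Qed.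

Lemma orderZ (c : R) x : O x -> O (tofrac c *: x).
Proof.
have [n [e [_ OE]]] := order_generators.
move=> /OE[d ->]; apply/OE; exists (fun i => c * d i).
by rewrite scaler_sumr; apply: eq_bigr => i _; rewrite scalerA rmorphM.
Qed.

(** * Integrality over [R] *)

(** A ring morphism although [F] need not be commutative: the coefficients act as central
    scalars. *)
Definition poly_eval (x : F) (p : {poly R}) : F :=
  horner_alg x (map_poly (@tofrac R) p).

Lemma poly_eval_is_zmod_morphism x : zmod_morphism (poly_eval x).
Proof. by move=> p q; rewrite /poly_eval !rmorphB. Qed.

Lemma poly_eval_is_monoid_morphism x : monoid_morphism (poly_eval x).
Proof. by split=> [|p q]; rewrite /poly_eval ?rmorph1 ?rmorphM. Qed.

HB.instance Definition _ x :=
  GRing.isZmodMorphism.Build _ _ (poly_eval x) (poly_eval_is_zmod_morphism x).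
HB.instance Definition _ x :=
  GRing.isMonoidMorphism.Build _ _ (poly_eval x) (poly_eval_is_monoid_morphism x).

Lemma poly_evalX x : poly_eval x 'X = x.
Proof. by rewrite /poly_eval map_polyX horner_algX. Qed.

Lemma poly_evalC x c : poly_eval x c%:P = (tofrac c)%:A.
Proof. by rewrite /poly_eval map_polyC horner_algC. Qed.

Lemma order_poly_eval x p : O x -> O (poly_eval x p).
Proof.
move=> Ox; elim/poly_ind: p => [|p c IH]; first by rewrite rmorph0; exact: order0.
rewrite rmorphD rmorphM /= poly_evalX poly_evalC.
by apply: orderD; [apply: orderM | apply/orderZ/order1].
Qed.

(* Cayley-Hamilton for left multiplication by [x] on the generators. *)
Lemma order_integral x : O x -> exists2 p : {poly R}, p \is monic & poly_eval x p = 0.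
Proof.
have [n [e [spane OE]]] := order_generators.
have [c c1] : exists c : 'I_n -> R, 1 = \sum_i tofrac (c i) *: e i.
  by apply/OE; apply: order1.
case: n e spane OE c c1 => [|n] e spane OE c c1 Ox.
  by move: c1 => /eqP; rewrite big_ord0 oner_eq0.
have Oe i : O (e i).
  apply/OE; exists (fun j => (i == j)%:R); rewrite (bigD1 i) //= eqxx rmorph1 scale1r.
  rewrite big1 ?addr0 // => j; rewrite eq_sym => /negPf ->.
  by rewrite rmorph0 scale0r.
have /choice[A AE] i : exists d : 'I_n.+1 -> R, x * e i = \sum_j tofrac (d j) *: e j.
  by apply/OE; apply: orderM.
pose M : 'M[R]_n.+1 := \matrix_(i, j) A i j.
(* [M] records left multiplication by [x] on the generators, so [p(x)] acts through [p(M)]. *)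
have evE p i : poly_eval x p * e i = \sum_j tofrac (horner_mx M p i j) *: e j.
  elim/poly_ind: p i => [|p d IH] i.
    by rewrite !rmorph0 mul0r big1 // => j _; rewrite mxE rmorph0 scale0r.
  rewrite rmorphD rmorphM /= [p * 'X]mulrC rmorphD rmorphM /=.
  rewrite poly_evalX poly_evalC horner_mx_X horner_mx_C.
  rewrite mulrDl -mulrA AE -scalerAl mul1r mulr_sumr.
  rewrite (eq_bigr (fun k => \sum_j
      tofrac (A i k) *: (tofrac (horner_mx M p k j) *: e j))); last first.
    by move=> k _; rewrite -scalerAr IH scaler_sumr.
  rewrite exchange_big /=.
  under [RHS]eq_bigr => j do rewrite mxE rmorphD scalerDl.
  rewrite big_split /=; congr (_ + _).
    apply: eq_bigr => j _; rewrite mxE rmorph_sum scaler_suml; apply: eq_bigr => k _.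
    by rewrite scalerA rmorphM mxE.
  rewrite (bigD1 i) //= mxE eqxx mulr1n big1 ?addr0 // => j.
  by rewrite eq_sym mxE => /negPf ->; rewrite mulr0n rmorph0 scale0r.
exists (char_poly M); first exact: char_poly_monic.
(* As 1 is a combination of generators, it suffices that [p(x)] kills each of them. *)
rewrite -[LHS]mulr1 c1 mulr_sumr big1 // => i _.
rewrite -scalerAr evE Cayley_Hamilton big1 ?scaler0 // => j _.
by rewrite mxE rmorph0 scale0r.
Qed.


(** * The [pi]-adic filtration and completeness of the order *)

Variable pi : R.
Hypotheses (pi_neq0 : pi != 0) (pi_nonunit : pi \isn't a GRing.unit)
  (pi_local : forall b, b \is a GRing.unit \/ exists c, b = pi * c)
  (pi_separated : forall b, (forall n, exists c, b = pi ^+ n * c) -> b = 0)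
  (pi_complete : forall u, adic_cauchy pi u -> exists x, adic_limit pi u x).

Lemma frac_pi_neq0 n : tofrac (pi ^+ n) != 0.
Proof. by rewrite tofrac_eq0 expf_neq0. Qed.

(** Separatedness gives a least power of [pi] not dividing [b]; the cofactor of the preceding power
    is not divisible by [pi], hence a unit. *)
Lemma pi_factor b : b != 0 -> exists n c, c \is a GRing.unit /\ b = pi ^+ n * c.
Proof.
move=> b0; have ndvd : exists n, `[< ~ exists c, b = pi ^+ n * c >].
  apply: contrapT => dvd; case/eqP: b0; apply: pi_separated => n.
  by apply: contrapT => ndvd; apply: dvd; exists n; apply/asboolP.
case: (ex_minnP ndvd) => -[|m] /asboolP mP min.
  by case: mP; exists b; rewrite expr0 mul1r.
have [c bE] : exists c, b = pi ^+ m * c.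
  apply: contrapT => mN.
  by have := min m (introT (asboolP _) mN); rewrite ltnn.
exists m, c; split=> //; have [//|[d cE]] := pi_local c.
by case: mP; exists d; rewrite bE cE exprSr mulrA.
Qed.

Lemma frac_clear_pi (k : {fraction R}) :
  exists n c, tofrac (pi ^+ n) * k = tofrac c.
Proof.
have [a [b [b0 ->]]] : exists a b, b != 0 /\ k = tofrac a / tofrac b.
  elim/quotW: k => x; exists \n_x, \d_x; split; first exact: denom_ratioP.
  apply: (canRL (mulfK _)); first by rewrite tofrac_eq0 denom_ratioP.
  unlock tofrac; rewrite -[LHS]FracField.pi_mul; apply/eqmodP.
  rewrite /= FracField.equivfE /FracField.mulf.
  by rewrite !numden_Ratio ?mulf_neq0 ?denom_ratioP ?oner_neq0 // !mulr1 mulrC.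
have [n [c [Uc ->]]] := pi_factor b0; exists n, (a * c^-1).
rewrite [tofrac (_ * c)]rmorphM /= invfM mulrCA mulVKf ?frac_pi_neq0 //.
have c0 : tofrac c != 0 by rewrite tofrac_eq0; apply: contraTneq Uc => ->; rewrite unitr0.
rewrite rmorphM; congr (_ * _); apply: (mulfI c0).
by rewrite divff // -rmorphM divrr // rmorph1.
Qed.

Lemma order_clear_pi z : exists n, O (tofrac (pi ^+ n) *: z).
Proof.
have [n [e [spane OE]]] := order_generators.
have [c ->] := spane z.
have /choice[m /choice[d cE]] i := frac_clear_pi (c i).
exists (\sum_i m i)%N; apply/OE.
exists (fun i => pi ^+ (\sum_(j | j != i) m j) * d i).
rewrite scaler_sumr; apply: eq_bigr => i _.
by rewrite scalerA (bigD1 i) //= addnC exprD rmorphM -mulrA cE -rmorphM.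
Qed.

(** These ideals of [O] define its [pi]-adic topology. *)
Definition pi_order n (x : F) := exists2 y, O y & x = tofrac (pi ^+ n) *: y.

Lemma pi_orderW n x : pi_order n x -> O x.
Proof. by move=> [y Oy ->]; apply: orderZ. Qed.

Lemma pi_order_order x : O x -> pi_order 0 x.
Proof. by move=> Ox; exists x; rewrite ?expr0 ?rmorph1 ?scale1r. Qed.

Lemma pi_orderN n x : pi_order n x -> pi_order n (- x).
Proof. by move=> [y Oy ->]; exists (- y); rewrite ?scalerN //; apply: orderN. Qed.

Lemma pi_orderD n x y : pi_order n x -> pi_order n y -> pi_order n (x + y).
Proof.
by move=> [u Ou ->] [v Ov ->]; exists (u + v); rewrite ?scalerDr //; apply: orderD.
Qed.

Lemma pi_orderM m n x y :
  pi_order m x -> pi_order n y -> pi_order (m + n) (x * y).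
Proof.
move=> [u Ou ->] [v Ov ->]; exists (u * v); first exact: orderM.
by rewrite -scalerAl -scalerAr scalerA exprD rmorphM.
Qed.

Lemma pi_orderMl n x y : O x -> pi_order n y -> pi_order n (x * y).
Proof. by move=> /pi_order_order; apply: pi_orderM. Qed.

Lemma pi_orderMr n x y : pi_order n x -> O y -> pi_order n (x * y).
Proof. by move=> xn /pi_order_order; rewrite -[n]addn0; apply: pi_orderM. Qed.

Lemma pi_order_le m n x : (m <= n)%N -> pi_order n x -> pi_order m x.
Proof.
move=> mn [y Oy ->]; exists (tofrac (pi ^+ (n - m)) *: y); first exact: orderZ.
by rewrite scalerA -rmorphM -exprD subnKC.
Qed.

(** If [1 = pi y], then [y = 1 / pi] is integral over [R]; multiplying its monic equation of degree
    [n] by [pi ^ n] exhibits 1 as a multiple of [pi] in [R]. *)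
Lemma pi_order1 : ~ pi_order 1 1.
Proof.
move=> [y Oy y1]; have [p p_monic p0] := order_integral Oy.
have pi0 : tofrac pi != 0 by rewrite tofrac_eq0.
have yE : y = (tofrac pi)^-1%:A.
  by rewrite y1 expr1 scalerA mulVf ?scale1r.
move: p0; rewrite /poly_eval yE /horner_alg /horner_morph horner_map /= => /eqP.
rewrite scaler_eq0 oner_eq0 orbF horner_coef size_map_inj_poly ?rmorph0 //; last first.
  by move=> u v /eqP; rewrite tofrac_eq => /eqP.
have [n sp] : exists n, size p = n.+1.
  by exists (size p).-1; rewrite prednK // size_poly_gt0 monic_neq0.
rewrite sp => /eqP p0; case/negP: pi_nonunit.
have : tofrac (\sum_(i < n) p`_i * pi ^+ (n - i)) + 1 = 0.
  rewrite -[RHS](mulr0 (tofrac pi ^+ n)) -p0 big_ord_recr /= mulrDr rmorph_sum mulr_sumr.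
  congr (_ + _); last first.
    have p1 : p`_n = 1 by move: (monicP p_monic); rewrite lead_coefE sp.
    by rewrite coef_map /= p1 rmorph1 mul1r exprVn divff // expf_neq0.
  apply: eq_bigr => i _; rewrite coef_map /= mulrCA rmorphM; congr (_ * _).
  by rewrite rmorphXn exprVn expfB.
rewrite -(rmorph1 (@tofrac R)) -rmorphD => /eqP; rewrite tofrac_eq0 addr_eq0 => /eqP pE.
apply/unitrPr; exists (- \sum_(i < n) p`_i * pi ^+ (n - i).-1).
rewrite mulrN mulr_sumr -[RHS]opprK -pE; congr (- _); apply: eq_bigr => i _.
by rewrite mulrCA -exprS prednK // subn_gt0.
Qed.

(** If [z] is nonzero, some [pi ^ m z^-1] lies in [O]; multiplied by [z] in [pi ^ (m + 1) O] it
    would put 1 in [pi O]. *)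
Lemma pi_order_separated z : (forall n, pi_order n z) -> z = 0.
Proof.
move=> zn; apply/eqP; apply: contrapT => /negP z0; apply: pi_order1.
have [m Om] := order_clear_pi z^-1; have [y Oy zE] := zn m.+1.
exists (y * (tofrac (pi ^+ m) *: z^-1)); first exact: orderM.
by rewrite -scalerAr scalerA -rmorphM -exprD add1n scalerAl -zE divrr // skewF.
Qed.

(** Convergence is reduced to [R]: the coefficient series over each generator is Cauchy. The
    generators need not be independent, so coefficients are chosen. *)
Lemma order_complete (u : nat -> F) : (forall i, O (u i)) ->
  exists2 s, O s & forall n, pi_order n (s - \sum_(i < n) tofrac (pi ^+ i) *: u i).
Proof.
move=> Ou; have [n [e [_ OE]]] := order_generators.
have /choice[c cE] i : exists c : 'I_n -> R, u i = \sum_k tofrac (c k) *: e k.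
  exact/OE.
pose S k m := \sum_(i < m) pi ^+ i * c i k.
have Sdiff k m m' : (m <= m')%N -> exists d, S k m' - S k m = pi ^+ m * d.
  move=> /subnKC <-; exists (\sum_(i < m' - m) pi ^+ i * c (m + i)%N k).
  rewrite /S big_split_ord /= [LHS]addrC addKr mulr_sumr.
  by apply: eq_bigr => i _; rewrite exprD mulrA.
have Scauchy k : adic_cauchy pi (S k).
  move=> m; exists m => i j mi mj; apply/principal_idealP.
  have [[d dE] [d' dE']] := (Sdiff k m i mi, Sdiff k m j mj).
  by exists (d - d'); rewrite mulrBr -dE -dE' opprB addrA subrK.
have /choice[x xP] k := pi_complete (Scauchy k).
have xS k m : exists d, x k - S k m = pi ^+ m * d.
  have [N /(_ (maxn m N))] := xP k m; rewrite leq_maxr => /(_ isT).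
  move=> /principal_idealP[d dE]; have [d' dE'] := Sdiff k m _ (leq_maxl m N).
  by exists (d' - d); rewrite mulrBr -dE -dE' opprB [RHS]addrC addrA subrK.
exists (\sum_k tofrac (x k) *: e k); first by apply/OE; exists x.
move=> m; have /choice[d dE] k := xS k m.
exists (\sum_k tofrac (d k) *: e k); first by apply/OE; exists d.
rewrite scaler_sumr; under [X in _ - X]eq_bigr do rewrite cE scaler_sumr.
rewrite exchange_big /= -sumrB; apply: eq_bigr => k _.
rewrite scalerA -rmorphM -dE rmorphB scalerBl rmorph_sum scaler_suml.
by congr (_ - _); apply: eq_bigr => i _; rewrite scalerA rmorphM.
Qed.

Definition order_unit x := [/\ O x, x != 0 & O x^-1].

Lemma order_unit_right_inverse x y : O x -> O y -> x * y = 1 -> order_unit x.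
Proof.
move=> Ox Oy xy1; have x0 : x != 0.
  by apply/eqP => x0; move/eqP: xy1; rewrite x0 mul0r eq_sym oner_eq0.
by split=> //; rewrite -[x^-1]mulr1 -xy1 mulKr //; apply: skewF.
Qed.

(** The inverse is the sum of the geometric series. *)
Lemma order_unit_sub_pi x : pi_order 1 x -> order_unit (1 - x).
Proof.
move=> [y Oy ->]; rewrite expr1.
have [|s Os sP] := @order_complete (fun i => y ^+ i); first by move=> i; apply: orderX.
apply: (order_unit_right_inverse _ Os).
  by apply/orderB/orderZ => //; apply: order1.
apply/eqP; rewrite -subr_eq0; apply/eqP/pi_order_separated => n.
pose x' := tofrac pi *: y; rewrite -/x'; have Ox' : O x' by apply: orderZ.
rewrite -[s](subrK (\sum_(i < n) tofrac (pi ^+ i) *: y ^+ i)) mulrDr -addrA.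
apply: pi_orderD; first by apply: pi_orderMl => //; apply: orderB => //; apply: order1.
rewrite (eq_bigr (fun i : 'I_n => x' ^+ i)); last first.
  by move=> i _; rewrite /x' exprZn rmorphXn.
have -> : (1 - x') * (\sum_(i < n) x' ^+ i) - 1 = - (x' ^+ n).
  by rewrite -[1 - x']opprB mulNr -subrX1 opprB addrC addKr.
apply: pi_orderN; exists (y ^+ n); first exact: orderX.
by rewrite /x' exprZn rmorphXn.
Qed.

(** * Lifting idempotents, and units of the order *)

(** Newton's step for [X ^ 2 - X], equal to [3 x ^ 2 - 2 x ^ 3]. The factor [2 x - 1] replaces the
    inverse of the derivative, its square being 1 plus 4 times the defect [x ^ 2 - x]. *)
Definition newton (x : F) := x - (x + x - 1) * (x ^+ 2 - x).

(** The new defect is a multiple of the square of the old one. Only powers of [x] occur, so the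
    identity is checked in the commutative ring [R[X]] and then evaluated. *)
Lemma newton_defect x :
  newton x ^+ 2 - newton x =
  (x ^+ 2 - x) * ((x ^+ 2 - x) * ((x ^+ 2 - x) *+ 4 - 3%:R)).
Proof.
pose X : {poly R} := 'X; pose D := X ^+ 2 - X.
have H : (X - (X + X - 1) * D) ^+ 2 - (X - (X + X - 1) * D) = D * (D * (D *+ 4 - 3%:R)).
  by rewrite /D; ring.
move: (congr1 (poly_eval x) H).
by rewrite /D !(rmorphB, rmorphD, rmorphM, rmorphXn, rmorphMn, rmorph1) /=
  poly_evalX rmorphN rmorph_nat.
Qed.

(** The Newton iterates converge to an idempotent [l] congruent to [e] modulo [pi]; in a skew field
    [l] is 0 or 1. *)
Lemma idempotent_lift e : O e -> pi_order 1 (e ^+ 2 - e) ->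
  pi_order 1 e \/ pi_order 1 (1 - e).
Proof.
move=> Oe e2; pose es n := iter n newton e.
have Oid x : O x -> O (x ^+ 2 - x) by move=> Ox; apply: orderB => //; apply: orderX.
have O2 x : O x -> O (x + x - 1).
  by move=> Ox; apply: orderB; [apply: orderD | apply: order1].
have Oes n : O (es n).
  elim: n => //= n IH; apply: orderB => //.
  by apply: orderM; [apply: O2 | apply: Oid].
have es2 n : pi_order n.+1 (es n ^+ 2 - es n).
  elim: n => //= n IH; rewrite newton_defect.
  apply: (@pi_order_le _ (n.+1 + n.+1)%N); first by rewrite addSn ltnS leq_addl.
  apply: pi_orderM => //; apply: pi_orderMr => //; apply: orderB.
    by rewrite -mulr_natr; apply: orderM; [exact: Oid | exact: order_nat].
  exact: order_nat.
(* The increment lies in [pi ^ (n + 1) O]. Splitting off only [pi ^ n] leaves [v] in [pi O], which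
   keeps the first iterate congruent to [e]. *)
have /choice[v vP] n : exists v, pi_order 1 v /\ es n.+1 - es n = tofrac (pi ^+ n) *: v.
  have [y Oy yE] := es2 n.
  exists (- ((es n + es n - 1) * (tofrac pi *: y))); split.
    apply/pi_orderN/pi_orderMl; first exact: O2.
    by exists y; rewrite ?expr1.
  rewrite /= {1}/newton addrC addKr yE scalerN scalerAr scalerA -rmorphM.
  by rewrite -exprSr.
have [|s Os sP] := @order_complete v; first by move=> i; case: (vP i) => /pi_orderW.
have sE n : \sum_(i < n) tofrac (pi ^+ i) *: v i = es n - e.
  elim: n => [|n IH]; first by rewrite big_ord0 subrr.
  by rewrite big_ord_recr /= IH; case: (vP n) => _ <-; rewrite addrC subrKA.
have limP n : pi_order n (e + s - es n).
  by have := sP n; rewrite sE opprB addrA [s + e]addrC.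
set l := e + s in limP.
have le : pi_order 1 (l - e).
  rewrite -(subrK (es 1%N) l) -addrA; apply: pi_orderD; first exact: limP.
  by case: (vP 0%N) => + ->; rewrite expr0 rmorph1 scale1r.
(* With [l = t + es n] and [t] in [pi ^ n O], the defect of [l] is small because that of [es n]
   is. *)
have l2 : l * (l - 1) = 0.
  apply: pi_order_separated => n; rewrite mulrBr mulr1.
  rewrite -[l](subrK (es n)); move: (limP n); set t := l - es n => tn.
  have -> : (t + es n) * (t + es n) - (t + es n)
      = t * (t + es n) + (es n * t - t + (es n ^+ 2 - es n)).
    by rewrite mulrDl mulrDr [es n * (_ + _)]mulrDr expr2 opprD -!addrA;
       congr (_ + (_ + (_ + _))); rewrite addrCA.
  have Ot := pi_orderW tn.
  apply: pi_orderD; first by apply: pi_orderMr => //; apply: orderD.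
  apply: pi_orderD; last exact: pi_order_le (es2 n).
  by apply: pi_orderD; [apply: pi_orderMl | apply: pi_orderN].
have [l0|l0] := eqVneq l 0.
  by left; move: le; rewrite l0 sub0r => /pi_orderN; rewrite opprK.
right; move: l2 => /(congr1 (fun z => l^-1 * z)); rewrite mulKr ?skewF // mulr0.
by move=> /eqP; rewrite subr_eq0 => /eqP <-.
Qed.

(* If [p] is monic, [p x = 0] and [j] is least such that the coefficient [p_j] is
   a unit, then [x ^ j (1 - b)] is in [pi O] for some [b = v(x) x], [v] a
   polynomial, and [b ^ (j + 1)] is idempotent modulo [pi]. *)
Lemma order_unit_or_nilpotent x : O x -> order_unit x \/ exists n, pi_order 1 (x ^+ n).
Proof.
move=> Ox; have [p p_monic p0] := order_integral Ox.
have exU : exists n, p`_n \is a GRing.unit.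
  by exists (size p).-1; move/monicP: p_monic; rewrite lead_coefE => ->; apply: unitr1.
have [j Uj jmin] := ex_minnP exU.
have [q takeE] : exists q : {poly R}, take_poly j p = pi%:P * q.
  have /choice[d dE] i : exists d, (i < j)%N -> p`_i = pi * d.
    case: (ltnP i j) => ij; last by exists 0.
    have [Ui|[d dE]] := pi_local p`_i; last by exists d.
    by move: (jmin i Ui); rewrite leqNgt ij.
  exists (\poly_(i < j) d i); apply/polyP => i; rewrite coef_take_poly coefCM coef_poly.
  by case: ltnP => [/dE|]; rewrite ?mulr0.
(* Modulo [pi], [p] is [X ^ j g] with [g(0) = p_j] a unit, and [g / g(0) = 1 - v X]; as [p(x) = 0],
   the value of [X ^ j (1 - v X)] at [x] lies in [pi O]. *)
pose g := drop_poly j p; have g0 : g`_0 \is a GRing.unit by rewrite coef_drop_poly add0n.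
pose v := - (g`_0)^-1%:P * drop_poly 1 g.
have gE : (g`_0)^-1%:P * g = 1 - v * 'X.
  rewrite -{2}[g](poly_take_drop 1) mulrDr expr1; congr (_ + _).
    apply/polyP => i; rewrite coefCM coef_take_poly coef1.
    by case: i => [|i] /=; rewrite ?mulVr ?mulr0.
  by rewrite /v !mulNr opprK mulrA.
pose B := v * 'X; pose E := B ^+ j.+1.
have xB : pi_order 1 (poly_eval x ('X^j * (1 - B))).
  have -> : 'X^j * (1 - B) = (g`_0)^-1%:P * p - pi%:P * ((g`_0)^-1%:P * q).
    rewrite -gE -{1}[p](poly_take_drop j) takeE -/g.
    by move: (_%:P) (pi%:P) 'X^j => c d X; ring.
  rewrite rmorphB !rmorphM /= p0 mulr0 sub0r !poly_evalC -!scalerAl !mul1r.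
  apply: pi_orderN; exists (tofrac (g`_0)^-1 *: poly_eval x q); last by rewrite expr1.
  by apply/orderZ/order_poly_eval.
have xE : pi_order 1 (poly_eval x ('X^j * (1 - E))).
  have -> : 'X^j * (1 - E) = 'X^j * (1 - B) * \sum_(i < j.+1) B ^+ i.
    by rewrite -mulrA -[1 - B]opprB mulNr -subrX1 opprB.
  by rewrite rmorphM; apply: pi_orderMr => //; apply: order_poly_eval.
(* [E] is divisible by [X ^ j], so [E (1 - E)] at [x] inherits membership in [pi O]. *)
have E2 : pi_order 1 (poly_eval x E ^+ 2 - poly_eval x E).
  have EE : E ^+ 2 - E = - (B * v ^+ j * ('X^j * (1 - E))).
    by rewrite mulrA -[B * _ * _]mulrA -exprMn -exprS -/E; ring.
  rewrite -rmorphXn -rmorphB EE rmorphN rmorphM; apply/pi_orderN/pi_orderMl => //.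
  exact: order_poly_eval.
(* If [E(x)] lies in [pi O], so does [x ^ j]; otherwise [E(x)], which has the factor [x], is a
   unit. *)
have [Epi|Epi] := idempotent_lift (order_poly_eval E Ox) E2.
  right; exists j; rewrite -(subrK (x ^+ j * poly_eval x E) (x ^+ j)).
  apply: pi_orderD; last by apply: pi_orderMl => //; apply: orderX.
  by move: xE; rewrite rmorphM rmorphB rmorph1 mulrBr mulr1 rmorphXn /= poly_evalX.
left; have [] := order_unit_sub_pi Epi; rewrite opprB addrC subrK => OE E0 OEV.
pose G := poly_eval x (v * B ^+ j).
have EG : poly_eval x E = x * G.
  by rewrite /E exprS {1}/B [v * 'X]mulrC -mulrA rmorphM /= poly_evalX.
apply: (@order_unit_right_inverse _ (G * (poly_eval x E)^-1)) => //.
  by apply: orderM => //; apply: order_poly_eval.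
by rewrite mulrA -EG divrr // skewF.
Qed.

(* Nonunits are topologically nilpotent, and the geometric series inverts
   [1 - x ^+ n] for large [n]. *)
Lemma order_unit_sub x : O x -> ~ order_unit x -> order_unit (1 - x).
Proof.
move=> Ox Nx; have [//|[n xn]] := order_unit_or_nilpotent Ox.
have [OU U0 OUV] := order_unit_sub_pi xn.
have sumE : 1 - x ^+ n = (1 - x) * \sum_(i < n) x ^+ i.
  by rewrite -[1 - x]opprB mulNr -subrX1 opprB.
apply: (@order_unit_right_inverse _ ((\sum_(i < n) x ^+ i) * (1 - x ^+ n)^-1)).
- by apply: orderB => //; apply: order1.
- apply: orderM => //; elim/big_ind: _ => [||i _].
  + exact: order0.
  + exact: orderD.
  + exact: orderX.
- by rewrite mulrA -sumE divrr // skewF.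
Qed.

(** * Locality and the radical of the order *)

Lemma order_nonunitM x y : O x -> O y -> ~ order_unit y -> ~ order_unit (x * y).
Proof.
move=> Ox Oy Ny [_ xy0 OxyV]; apply: Ny.
have y0 : y != 0 by apply: contraNneq xy0 => ->; rewrite mulr0.
have x0 : x != 0 by apply: contraNneq xy0 => ->; rewrite mul0r.
split=> //; have -> : y^-1 = (x * y)^-1 * x; last exact: orderM.
by rewrite invrM ?skewF // mulrVK // skewF.
Qed.

Lemma order_unit1 : order_unit 1.
Proof. by split; rewrite ?oner_neq0 ?invr1 //; apply: order1. Qed.

(** For sums: if [u = x + y] were a unit, the nonunit [u^-1 y] would equal [1 - u^-1 x], a unit. *)
Lemma nonunits_left_ideal : left_ideal O [set x | O x /\ ~ order_unit x].
Proof.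
split=> [x []//| |x y [Ox Nx] [Oy Ny]|a x Oa [Ox Nx]].
- by split=> [|[_]]; [exact: order0 | rewrite eqxx].
- split=> [|Uxy]; first exact: orderD.
  have [OU U0 OUV] := Uxy; set u := x + y in Uxy OU U0 OUV.
  have : ~ order_unit (u^-1 * y) by apply: order_nonunitM.
  apply; have -> : u^-1 * y = 1 - u^-1 * x.
    by rewrite -(mulVr (skewF U0)) -mulrBr {3}/u [x + y]addrC addrK.
  by apply: order_unit_sub; [apply: orderM | apply: order_nonunitM].
- by split; [apply: orderM | apply: order_nonunitM].
Qed.

(** The nonunits form a maximal left ideal. Conversely, a nonunit [x] outside a maximal [L] would
    give [1 = l + a x] with [l] in [L], and [l = 1 - a x] is a unit. *)
Lemma jacobson_radicalE : jacobson_radical O = [set x | O x /\ ~ order_unit x].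
Proof.
apply/seteqP; split=> x [Ox radx]; split=> //.
  have maxN : maximal_left_ideal O [set x | O x /\ ~ order_unit x].
    split; first exact: nonunits_left_ideal.
      move=> NE; have [_] : [set x | O x /\ ~ order_unit x] 1 by rewrite NE; apply: order1.
      by apply; apply: order_unit1.
    move=> J [JO J0 JD JM] NJ JneO; apply/seteqP; split=> // y Jy; split; first exact: JO.
    move=> [_ y0 OyV]; apply: JneO; apply/seteqP; split=> // z Oz.
    by rewrite -[z]mulr1 -(mulVr (skewF y0)) mulrA; apply: JM => //; apply: orderM.
  by case: (radx _ maxN).
move=> L [[LO L0 LD LM] LneO Lmax]; apply: contrapT => NLx.
pose J := [set z | exists a l, [/\ O a, L l & z = l + a * x]].
have JI : left_ideal O J.
  split.
  - by move=> _ [a [l [Oa Ll ->]]]; apply: orderD; [apply: LO | apply: orderM].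
  - by exists 0, 0; split=> //; [exact: order0 | rewrite mul0r addr0].
  - move=> _ _ [a [l [Oa Ll ->]]] [b [m [Ob Lm ->]]]; exists (a + b), (l + m).
    by split; [apply: orderD | apply: LD | rewrite mulrDl addrACA].
  - move=> b _ Ob [a [l [Oa Ll ->]]]; exists (b * a), (b * l).
    by split; [apply: orderM | apply: LM | rewrite mulrDr mulrA].
have LJ : L `<=` J by move=> l Ll; exists 0, l; split=> //;
  [exact: order0 | rewrite mul0r addr0].
have Jx : J x by exists 1, 0; split=> //; [exact: order1 | rewrite mul1r add0r].
have [JO|JneO] := pselect (J = O); last by apply: NLx; rewrite -(Lmax J JI LJ JneO).
have [a [l [Oa Ll lE]]] : J 1 by rewrite JO; apply: order1.
have [OU U0 OUV] : order_unit l.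
  have -> : l = 1 - a * x by rewrite lE addrK.
  by apply: order_unit_sub; [apply: orderM | apply: order_nonunitM].
apply: LneO; apply/seteqP; split=> // z Oz.
by rewrite -[z]mulr1 -(mulVr (skewF U0)) mulrA; apply: LM => //; apply: orderM.
Qed.

(** * The prime element and its valuation *)

Variable w : F.
Hypotheses (radw : jacobson_radical O w)
  (radl : jacobson_radical O = lmul_set w O) (radr : jacobson_radical O = rmul_set O w).

Lemma prime_order : O w. Proof. by case: radw. Qed.

(** The image of [pi] is a nonzero nonunit of [O], so the radical [w O] is nonzero. *)
Lemma prime_neq0 : w != 0.
Proof.
have : jacobson_radical O (tofrac pi)%:A.
  rewrite jacobson_radicalE; split; first by apply/orderZ/order1.
  move=> [_ pi0 OpiV]; apply: pi_order1; exists ((tofrac pi)%:A^-1) => //.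
  by rewrite expr1 -[_^-1]mul1r scalerAl divrr // skewF.
rewrite radl => -[y Oy wy]; apply/eqP => w0; move/eqP: wy; apply/negP.
by rewrite w0 mul0r eq_sym scaler_eq0 oner_eq0 orbF tofrac_eq0.
Qed.

Lemma prime_unit : w \is a GRing.unit. Proof. exact/skewF/prime_neq0. Qed.

Lemma prime_conj y : O y -> O (w * y * w^-1) /\ O (w^-1 * y * w).
Proof.
move=> Oy; split.
  have : rmul_set O w (w * y) by rewrite -radr radl; exists y.
  by move=> [z Oz <-]; rewrite mulrK ?prime_unit.
have : lmul_set w O (y * w) by rewrite -radl radr; exists y.
by move=> [z Oz zE]; rewrite -mulrA -zE mulKr ?prime_unit.
Qed.

Lemma prime_order_unit z : O z -> ~ O (w^-1 * z) -> O z^-1.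
Proof.
move=> Oz Nwz; apply: contrapT => NOzV; apply: Nwz.
have : jacobson_radical O z by rewrite jacobson_radicalE; split=> // -[].
by rewrite radl => -[y Oy <-]; rewrite mulKr ?prime_unit.
Qed.

Lemma prime_radicalP z : jacobson_radical O z <-> O (w^-1 * z).
Proof.
rewrite radl; split=> [[y Oy <-]|Oz]; first by rewrite mulKr ?prime_unit.
by exists (w^-1 * z) => //; rewrite mulVKr ?prime_unit.
Qed.

(** Some power of [w] lies in [pi O]. Hence a large power of [w] brings [x] into [O], and no nonzero
    element survives division by all powers of [w]; the last exponent before leaving [O] is the
    valuation. *)
Lemma prime_valuation x : x != 0 ->
  exists n : int, O (w ^ (- n) * x) /\ ~ O (w ^ (- (n + 1)) * x).
Proof.
move=> x0.
have [e we] : exists e, pi_order 1 (w ^+ e).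
  move: radw; rewrite jacobson_radicalE => -[Ow Nw].
  by have [] := order_unit_or_nilpotent Ow.
have wem m : pi_order m (w ^+ (e * m)).
  rewrite exprM; elim: m => [|m IH].
    by rewrite expr0; apply/pi_order_order/order1.
  by rewrite exprSr -addn1; apply: pi_orderM.
have [m Om] : exists m, O (w ^+ m * x).
  have [m Om] := order_clear_pi x; exists (e * m)%N.
  have [y Oy ->] := wem m; rewrite -scalerAl scalerAr; exact: orderM.
have wz i : w ^ (- i%:Z) * w ^+ i = 1.
  by rewrite exprnP -exprzDr ?prime_unit // addNr.
have exN : exists k, `[< ~ O (w ^ (- k%:Z) * (w ^+ m * x)) >].
  apply: contrapT => allO; case/eqP: x0.
  rewrite -[x]mul1r -(wz m) -mulrA; set z := w ^+ m * x in allO *.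
  suff -> : z = 0 by rewrite mulr0.
  apply: pi_order_separated => k; pose k' := (e * k)%N.
  have -> : z = w ^+ k' * (w ^ (- k'%:Z) * z).
    by rewrite mulrA exprnP -exprzDr ?prime_unit // subrr mul1r.
  apply: pi_orderMr => //; apply: contrapT => Nz.
  by apply: allO; exists k'; apply/asboolP.
case: (ex_minnP exN) => -[|k] /asboolP Nk kmin; first by rewrite mul1r in Nk.
have Ok : O (w ^ (- k%:Z) * (w ^+ m * x)).
  apply: contrapT => Nk'.
  by have := kmin k (introT (asboolP _) Nk'); rewrite ltnn.
exists (k%:Z - m%:Z); split.
  by move: Ok; rewrite exprnP mulrA -exprzDr ?prime_unit // opprB addrC.
move: Nk; rewrite exprnP mulrA -exprzDr ?prime_unit //.
by rewrite (_ : - (k%:Z - m%:Z + 1) = - k.+1%:Z + m%:Z) //; lia.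
Qed.

End Order.

(** * Lattice chains and the normalizer of a hereditary order *)

Section Valuation.

(** * Fractional ideals of the valuation ring *)

Variables (K : fieldType) (F : falgType K) (O : set F) (w : F).
Hypotheses (skewF : skew_field F) (O1 : O 1) (OB : forall x y, O x -> O y -> O (x - y))
  (OM : forall x y, O x -> O y -> O (x * y)) (Ow : O w) (Uw : w \is a GRing.unit)
  (Oconj : forall y, O y -> O (w * y * w^-1) /\ O (w^-1 * y * w))
  (OV : forall z, O z -> ~ O (w^-1 * z) -> O z^-1)
  (Oval : forall x, x != 0 ->
     exists n : int, O (w ^ (- n) * x) /\ ~ O (w ^ (- (n + 1)) * x)).
Implicit Types (x y z : F) (m n : int).

(* [fil n] is the fractional ideal [w ^ n O = O w ^ n]. *)
Definition fil (n : int) (x : F) := O (w ^ (- n) * x).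

Let wD m n : w ^ (m + n) = w ^ m * w ^ n. Proof. exact: exprzDr. Qed.

Lemma fil_ring x : fil 0 x <-> O x.
Proof. by rewrite /fil oppr0 expr0z mul1r. Qed.

Lemma filB n x y : fil n x -> fil n y -> fil n (x - y).
Proof. by rewrite /fil mulrBr; apply: OB. Qed.

Lemma fil0 n : fil n 0.
Proof. by rewrite /fil mulr0 -(subrr 1); apply: OB. Qed.

Lemma filD n x y : fil n x -> fil n y -> fil n (x + y).
Proof.
move=> xn yn; rewrite -[y]opprK; apply: filB => //.
by rewrite -sub0r; apply: filB => //; apply: fil0.
Qed.

Lemma fil_sum (I : finType) (f : I -> F) n :
  (forall i, fil n (f i)) -> fil n (\sum_i f i).
Proof. by move=> fn; elim/big_ind: _ => //; [exact: fil0 | exact: filD]. Qed.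

Lemma fil_conj n y : O y -> O (w ^ n * y * w ^ (- n)).
Proof.
move=> Oy; elim/int_rect: n => [|n IH|n IH].
- by rewrite oppr0 expr0z mul1r mulr1.
- have -> : w ^ n.+1 * y * w ^ (- n.+1%:Z) = w * (w ^ n * y * w ^ (- n%:Z)) * w^-1.
    by rewrite intS opprD [- 1 + _]addrC !wD expr1z exprN1 !mulrA.
  by case: (Oconj IH).
- rewrite opprK in IH *.
  have -> : w ^ (- n.+1%:Z) * y * w ^ n.+1 = w^-1 * (w ^ (- n%:Z) * y * w ^ n) * w.
    by rewrite intS opprD [1 + _]addrC !wD expr1z exprN1 !mulrA.
  by case: (Oconj IH).
Qed.

Lemma filM m n x y : fil m x -> fil n y -> fil (m + n) (x * y).
Proof.
rewrite /fil => xm yn.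
have -> : w ^ (- (m + n)) * (x * y)
    = w ^ (- n) * (w ^ (- m) * x) * w ^ (- - n) * (w ^ (- n) * y).
  rewrite opprD [- m + _]addrC wD opprK !mulrA.
  by rewrite -[_ * w ^ n * _]mulrA -(wD n) subrr expr0z mulr1.
by apply: OM => //; apply: fil_conj.
Qed.

Lemma filX n : fil n (w ^ n).
Proof. by rewrite /fil -wD addNr. Qed.

Lemma fil_le m n x : (m <= n)%R -> fil n x -> fil m x.
Proof.
move=> mn xn; have -> : x = w ^ (n - m) * (w ^ (m - n) * x).
  by rewrite mulrA -wD addrA subrK subrr expr0z mul1r.
have Owk (k : nat) : O (w ^ k).
  elim: k => [|k IH]; first by rewrite expr0z.
  by rewrite intS wD expr1z; apply: OM.
have := @filM 0 m; rewrite add0r; apply.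
  by apply/fil_ring; rewrite (_ : n - m = `|n - m|%N) //; lia.
by rewrite /fil mulrA -wD (_ : - m + (m - n) = - n) //; lia.
Qed.

(** The integer is the valuation of [x]. The last clause holds because [w ^ (- n) x] is a unit of
    [O]. *)
Lemma fil_exact x : x != 0 -> exists n,
  [/\ fil n x, forall m, fil m x -> (m <= n)%R
    & forall y, fil n y -> exists2 z, O z & y = x * z].
Proof.
move=> x0; have [n [xn Nxn]] := Oval x0; exists n; split=> // [m xm|y yn].
  have : ~~ (n + 1 <= m)%R by apply/negP => nm; apply: Nxn; apply: fil_le xm.
  by lia.
have Ux := skewF x0.
exists (x^-1 * y); last by rewrite mulVKr.
have -> : x^-1 * y = (w ^ (- n) * x)^-1 * (w ^ (- n) * y).
  by rewrite invrM ?unitrXz // -mulrA mulKr ?unitrXz.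
apply: OM => //; apply: OV => //.
by rewrite mulrA -exprN1 -wD -opprD addrC.
Qed.

(** First, 1 is not in [fil 1], since multiplying by it would raise a valuation. If [w ^ n] had
    valuation [k > n], then 1 would lie in [fil (k - n)]. *)
Lemma filX_le m n : fil m (w ^ n) -> (m <= n)%R.
Proof.
move=> mn; have Uwn : w ^ n \is a GRing.unit by rewrite unitrXz.
have wn0 : w ^ n != 0 by apply: contraTneq Uwn => ->; rewrite unitr0.
have [k [kn kmax kgen]] := fil_exact wn0.
have := kmax _ mn; suff : (k <= n)%R by lia.
have : ~ fil 1 1.
  move=> w1; have [i [oi imax _]] := fil_exact (oner_neq0 F).
  by have := filM oi w1; rewrite mulr1 => /imax; lia.
have : fil (k - n) (w ^ n * w ^ (- n)) by apply: filM kn (filX _).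
rewrite -wD subrr expr0z => k1 N1.
have : ~~ (1 <= k - n)%R by apply/negP => kn1; apply: N1; apply: fil_le k1.
by lia.
Qed.

Lemma filMXr m n x : fil (m + n) (x * w ^ n) <-> fil m x.
Proof.
split=> [H|H]; last exact/filM/filX.
have := filM H (filX (- n)).
by rewrite -mulrA -wD subrr expr0z mulr1 addrK.
Qed.

(** Take the largest [m] with [S] inside [fil m]: an element of [S] outside [fil (m + 1)] has
    valuation [m] and generates [fil m]. *)
Lemma submodule_fil (S : set F) : (forall x z, S x -> O z -> S (x * z)) ->
    (exists2 x, S x & x != 0) -> (exists n, forall x, S x -> fil n x) ->
  exists n, forall x, S x <-> fil n x.
Proof.
move=> SM [x Sx x0] [n Sn].
have exN : exists k : nat, `[< ~ forall x, S x -> fil (n + k%:Z) x >].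
  have [m [_ mmax _]] := fil_exact x0; exists (absz (m + 1 - n)%R); apply/asboolP => H.
  by have := mmax _ (H x Sx); lia.
case: (ex_minnP exN) => -[|k] /asboolP Nk kmin; first by rewrite addr0 in Nk.
have Ok z : S z -> fil (n + k%:Z) z.
  apply: contrapT => Nk'; suff : (k.+1 <= k)%N by rewrite ltnn.
  by apply: kmin; apply/asboolP => H; apply: Nk' => Sz; apply: H.
have [z /not_implyP[Sz Nz]] : exists z, ~ (S z -> fil (n + k.+1%:Z) z).
  by apply/existsNP.
exists (n + k%:Z) => y; split=> [/Ok //|yk].
have z0 : z != 0 by apply/eqP => z0; apply: Nz; rewrite z0; apply: fil0.
have [m [zm mmax mgen]] := fil_exact z0.
have [|u Ou ->] := mgen y; last exact: SM.
apply: fil_le yk; have := mmax _ (Ok _ Sz).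
have : ~~ (n + k.+1%:Z <= m)%R by apply/negP => H; apply: Nz; apply: fil_le zm.
by lia.
Qed.

Lemma fil_bound (I : finType) (f : I -> F) :
  exists n, forall i, fil n (f i).
Proof.
have /choice[d dP] i : exists n, fil n (f i).
  have [->|x0] := eqVneq (f i) 0; first by exists 0; apply: fil0.
  by have [n [? _ _]] := fil_exact x0; exists n.
exists (- (\sum_i `|d i|%N)%:Z) => i; apply: fil_le (dP i).
by rewrite (bigD1 i) //=; lia.
Qed.

(** * The lattice chain and its shifts *)

Variables (N r : nat) (blk : 'I_N -> nat).
Hypotheses (r_gt0 : (0 < r)%N) (blk_lt : forall a, (blk a < r)%N)
  (blk_surj : forall i, (i < r)%N -> exists a, blk a = i).
Implicit Types (a b : 'I_N) (c i j : int) (v : 'cV[F]_N).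

(* The ceiling of [(j - blk a) / r]. *)
Definition lev (j : int) (a : 'I_N) : int := - (((blk a)%:Z - j) %/ r%:Z)%Z.

Lemma r_neq0 : r%:Z != 0.
Proof. by have := r_gt0; lia. Qed.

(** The adjunction characterizing the ceiling, from which bounds on [lev] are derived. *)
Lemma lev_le j a m : (lev j a <= m)%R = (j <= m * r%:Z + (blk a)%:Z)%R.
Proof. by rewrite /lev lerNl lez_divRL ?ltz_nat //; apply/idP/idP; lia. Qed.

Lemma lev_self j a : (j <= lev j a * r%:Z + (blk a)%:Z)%R.
Proof. by rewrite -lev_le. Qed.

Lemma lev_mono i j a : (i <= j)%R -> (lev i a <= lev j a)%R.
Proof. by move=> ij; rewrite lev_le; apply: le_trans (lev_self j a). Qed.

Lemma lev_eq j a m :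
  (j <= m * r%:Z + (blk a)%:Z)%R -> (m * r%:Z + (blk a)%:Z < j + r%:Z)%R -> lev j a = m.
Proof.
move=> jm mj; apply: le_anti; rewrite lev_le jm /=.
rewrite leNgt; apply/negP; rewrite -lezD1 => Lm.
have : ((lev j a + 1) * r%:Z <= m * r%:Z)%R by rewrite ler_wpM2r.
by have := lev_self j a; lia.
Qed.

Lemma lev_shift j a m : lev (j + m * r%:Z) a = lev j a + m.
Proof.
rewrite /lev opprD addrA -mulNr addrC divzMDl; last exact: r_neq0.
by rewrite opprD opprK; apply: addrC.
Qed.

(** Every residue modulo [r] is the index of a nonempty block, so the chain drops strictly at every
    step. *)
Lemma lev_surj j : exists a, j = lev j a * r%:Z + (blk a)%:Z.
Proof.
have r0 := r_neq0.
have [|a aE] := @blk_surj `|(j %% r%:Z)%Z|%N.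
  by have := ltz_pmod j (_ : (0 < r%:Z)%R); have := modz_ge0 j r0; lia.
have jE : j = (j %/ r%:Z)%Z * r%:Z + (blk a)%:Z.
  by rewrite {1}(divz_eq j r%:Z) aE gez0_abs // modz_ge0.
exists a; have := lev_self j a; have : (lev j a <= (j %/ r%:Z)%Z)%R by rewrite lev_le -jE.
have := r_gt0; nia.
Qed.

(* The columns in [lat j] form a right [O]-lattice stable under the hereditary
   order. *)
Definition lat (j : int) (v : 'cV[F]_N) := forall a, fil (lev j a) (v a 0).

(* An entrywise form of [x L_j <= L_(j + c)] for all [j], where [L_j = lat j];
   the hereditary order is the case [c = 0]. *)
Definition shifts (c : int) (x : 'M[F]_N) :=
  forall j a b, fil (lev (j + c) a - lev j b) (x a b).

Lemma lat_le i j v : (i <= j)%R -> lat j v -> lat i v.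
Proof. by move=> ij vj a; apply: fil_le (vj a); apply: lev_mono. Qed.

Lemma lat_sum (I : finType) (f : I -> 'cV[F]_N) j :
  (forall k, lat j (f k)) -> lat j (\sum_k f k).
Proof. by move=> fj a; rewrite summxE; apply: fil_sum => k; apply: fj. Qed.

(** Tested on the column of least valuations in [lat i], at a coordinate where the chain drops at
    [i]. *)
Lemma lat_le_inj i j : (forall v, lat i v -> lat j v) -> (j <= i)%R.
Proof.
move=> ij; have [a aE] := lev_surj i.
have /ij/(_ a) : lat i (\col_b w ^ lev i b) by move=> b; rewrite mxE; apply: filX.
by rewrite mxE => /filX_le; rewrite lev_le -aE.
Qed.

Lemma lat_inj i j : (forall v, lat i v <-> lat j v) -> i = j.
Proof.
by move=> ij; apply: le_anti; rewrite !lat_le_inj // => v /ij.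
Qed.

Lemma shifts_lat c (x : 'M[F]_N) j v : shifts c x -> lat j v -> lat (j + c) (x *m v).
Proof.
move=> xc vj a; rewrite mxE; apply: fil_sum => b.
by rewrite -(subrK (lev j b) (lev (j + c) a)); apply: filM.
Qed.

Definition delta_col b y : 'cV[F]_N := \col_a (if a == b then y else 0).

Lemma mul_delta_col (x : 'M[F]_N) b y a : (x *m delta_col b y) a 0 = x a b * y.
Proof.
rewrite mxE (bigD1 b) //= mxE eqxx big1 ?addr0 // => i /negPf bi.
by rewrite mxE bi mulr0.
Qed.

Lemma delta_col_lat b j n : (lev j b <= n)%R -> lat j (delta_col b (w ^ n)).
Proof.
move=> jn a; rewrite mxE; case: eqP => [->|_]; last exact: fil0.
by apply: fil_le jn _; apply: filX.
Qed.

(** Tested on columns with a single nonzero entry of least valuation. *)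
Lemma lat_shifts c (x : 'M[F]_N) : (forall j v, lat j v -> lat (j + c) (x *m v)) -> shifts c x.
Proof.
move=> xc j a b; have := xc j _ (delta_col_lat (lexx (lev j b))) => /(_ a).
by rewrite mul_delta_col -{1}(subrK (lev j b) (lev _ a)) => /filMXr.
Qed.

Lemma shiftsM c d (x y : 'M[F]_N) : shifts c x -> shifts d y -> shifts (d + c) (x *m y).
Proof.
move=> xc yd; apply: lat_shifts => j v vj.
by rewrite addrA -mulmxA; do 2! apply: shifts_lat => //.
Qed.

(** This is the block shape of the hereditary order. Over all [j], the difference
    [lev j a - lev j b] is largest at [j = blk b], where [lev j b = 0]. *)
Lemma shifts0P (x : 'M[F]_N) : shifts 0 x <-> forall a b, fil (blk a < blk b)%N%:Z (x a b).
Proof.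
split=> [H a b|H j a b].
  have := H (blk b)%:Z a b; rewrite addr0.
  rewrite (@lev_eq _ b 0) ?subr0; [|lia|by have := blk_lt b; lia].
  rewrite (@lev_eq _ a (blk a < blk b)%N%:Z) //; have := blk_lt a; have := blk_lt b;
    case: (ltnP (blk a) (blk b)); lia.
apply: fil_le (H a b); rewrite addr0 lerBlDr lev_le.
have := lev_self j b; have := blk_lt a; have := blk_lt b.
case: (ltnP (blk a) (blk b)); nia.
Qed.

Lemma shifts1 : shifts 0 1%:M.
Proof.
apply/shifts0P => a b; rewrite mxE; case: eqP => [->|_]; last exact: fil0.
by rewrite ltnn; apply/fil_ring.
Qed.

Lemma shifts_scalar m : shifts (m * r%:Z) (w ^ m)%:M.
Proof.
move=> j a b; rewrite mxE; case: eqP => [->|_]; last exact: fil0.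
by rewrite lev_shift addrAC subrr add0r; apply: filX.
Qed.

Definition entry_mx a b y : 'M[F]_N :=
  \matrix_(i, j) (if (i == a) && (j == b) then y else 0).

Lemma mul_entry_mx a b y v a' :
  (entry_mx a b y *m v) a' 0 = if a' == a then y * v b 0 else 0.
Proof.
rewrite mxE (bigD1 b) //= big1 ?addr0 => [|k /negPf kb]; rewrite mxE ?eqxx ?kb ?andbT ?andbF.
  by case: eqP; rewrite ?mul0r.
by rewrite mul0r.
Qed.

Lemma entry_mx_shifts a b y : fil (blk a < blk b)%N%:Z y -> shifts 0 (entry_mx a b y).
Proof.
move=> yab; apply/shifts0P => i j; rewrite mxE.
by case: andP => [[/eqP-> /eqP->]|_] //; apply: fil0.
Qed.

(* [x L_j] is stable under the hereditary order, hence the product of its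
   coordinate projections [S a = w ^ m a O], and stability forces
   [m a <= m b + 1] if [blk a < blk b] and [m a <= m b] otherwise; this says
   that [m] is the level function of some [L_c]. *)
Lemma lat_image (x y : 'M[F]_N) : x *m y = 1%:M -> y *m x = 1%:M ->
    (forall h, shifts 0 h -> shifts 0 (y *m h *m x)) ->
  forall j, exists c, forall v, lat j v <-> lat c (x *m v).
Proof.
move=> xy1 yx1 normx j.
pose S a : set F := [set z | exists2 v, lat j v & z = (x *m v) a 0].
have latH h v : shifts 0 h -> lat j v -> lat j (y *m (h *m (x *m v))).
  move=> /normx hj vj; rewrite !mulmxA -[j]addr0; exact: shifts_lat.
have SH h a v : shifts 0 h -> lat j v -> S a ((h *m (x *m v)) a 0).
  move=> Hh vj; exists (y *m (h *m (x *m v))); first exact: latH.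
  by rewrite [x *m (y *m _)]mulmxA xy1 mul1mx.
have /choice[m mP] a : exists n, forall z, S a z <-> fil n z.
  apply: submodule_fil.
  - move=> _ z [v vj ->] Oz; exists (\col_b (v b 0 * z)).
      by move=> b; rewrite mxE -[lev j b]addr0; apply: filM => //; apply/fil_ring.
    by rewrite !mxE mulr_suml; apply: eq_bigr => b _; rewrite mxE mulrA.
  - have [b xab] : exists b, x a b != 0.
      apply: contrapT => x0; have /matrixP/(_ a a) := xy1; rewrite !mxE eqxx big1.
        by move/esym/eqP; rewrite oner_eq0.
      move=> b _; have [->|xab] := eqVneq (x a b) 0; first by rewrite mul0r.
      by case: x0; exists b.
    exists (x a b * w ^ lev j b).
      by exists (delta_col b (w ^ lev j b)); [apply: delta_col_lat | rewrite mul_delta_col].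
    by rewrite (can2_eq (mulrK _) (mulrVK _)) ?mul0r // unitrXz.
  - have [n xn] := fil_bound (fun b => x a b * w ^ lev j b).
    exists n => _ [v vj ->]; rewrite mxE; apply: fil_sum => b.
    rewrite -(subrK (lev j b) n); apply: filM => //.
    by apply/(filMXr _ (lev j b)); rewrite subrK.
have m_le a b : (m a <= m b + (blk a < blk b)%N%:Z)%R.
  have /mP[v vj vE] : fil (m b) (w ^ m b) by apply: filX.
  set e := (blk a < blk b)%N%:Z.
  have := SH (entry_mx a b (w ^ e)) a v (entry_mx_shifts (filX _)) vj.
  rewrite mul_entry_mx eqxx -vE -wD => /mP; rewrite addrC; exact: filX_le.
(* The minimum of [m a * r + blk a] is the index sought: [m_le] keeps all these numbers within less
   than [r] of it, so its levels are the [m a]. *)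
have [b bmin] : exists b, forall a, (m b * r%:Z + (blk b)%:Z <= m a * r%:Z + (blk a)%:Z)%R.
  have [a0 _] := blk_surj r_gt0.
  have [b _ bmin] := @Order.TotalTheory.arg_minP _ _ _ a0 xpredT
    (fun a => m a * r%:Z + (blk a)%:Z) isT.
  by exists b => a; apply: bmin.
exists (m b * r%:Z + (blk b)%:Z) => v.
have levE a : lev (m b * r%:Z + (blk b)%:Z) a = m a.
  apply: lev_eq; first exact: bmin.
  have := m_le a b; have := blk_lt a; have := blk_lt b.
  by case: (ltnP (blk a) (blk b)); nia.
split=> [vj a|uc]; first by rewrite levE; apply/mP; exists v.
(* Each coordinate of [x v] is attained by its own [V a]; the diagonal idempotents, which lie in the
   hereditary order, recombine them. *)
have /choice[V VP] a : exists V, lat j V /\ (x *m v) a 0 = (x *m V) a 0.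
  by have := uc a; rewrite levE => /mP[V Vj VE]; exists V.
have xvE : x *m v = \sum_a entry_mx a a 1 *m (x *m V a).
  apply/colP => a; rewrite summxE (bigD1 a) //= big1 ?addr0 => [|b' /negPf ab].
    by rewrite mul_entry_mx eqxx mul1r; case: (VP a).
  by rewrite mul_entry_mx eq_sym ab.
have -> : v = \sum_a y *m (entry_mx a a 1 *m (x *m V a)).
  by rewrite -mulmx_sumr -xvE mulmxA yx1 mul1mx.
apply: lat_sum => a; apply: latH; last by case: (VP a).
by apply: entry_mx_shifts; rewrite ltnn; apply/fil_ring.
Qed.

(** [x] and [y] induce mutually inverse monotone maps on the indices of the chain, and a monotone
    bijection of the integers is a translation. *)
Lemma normalizer_shifts (x y : 'M[F]_N) : x *m y = 1%:M -> y *m x = 1%:M ->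
    (forall h, shifts 0 h -> shifts 0 (y *m h *m x)) ->
    (forall h, shifts 0 h -> shifts 0 (x *m h *m y)) ->
  exists c, shifts c x /\ shifts (- c) y.
Proof.
move=> xy1 yx1 normx normy.
have /choice[c cP] := lat_image xy1 yx1 normx.
have /choice[d dP] := lat_image yx1 xy1 normy.
have cd j : c (d j) = j.
  apply: lat_inj => v; have := cP (d j) (y *m v); rewrite mulmxA xy1 mul1mx => H.
  exact: iff_trans (iff_sym H) (iff_sym (dP j v)).
have dc j : d (c j) = j.
  apply: lat_inj => v; have := dP (c j) (x *m v); rewrite mulmxA yx1 mul1mx => H.
  exact: iff_trans (iff_sym H) (iff_sym (cP j v)).
have c_mono i j : (i <= j)%R -> (c i <= c j)%R.
  move=> ij; apply: lat_le_inj => v.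
  have := cP j (y *m v); have := cP i (y *m v); rewrite mulmxA xy1 mul1mx.
  by move=> Hi Hj /Hj/(lat_le ij)/Hi.
have d_mono i j : (i <= j)%R -> (d i <= d j)%R.
  move=> ij; apply: lat_le_inj => v.
  have := dP j (x *m v); have := dP i (x *m v); rewrite mulmxA yx1 mul1mx.
  by move=> Hi Hj /Hj/(lat_le ij)/Hi.
have cS j : c (j + 1) = c j + 1.
  have cj : (c j <= c (j + 1))%R by apply: c_mono; lia.
  have cjN : c j != c (j + 1).
    by apply/eqP => /(congr1 d); rewrite !dc; lia.
  have dj : (d (c j + 1) <= j + 1)%R by rewrite -[leRHS]dc; apply: d_mono; lia.
  have djN : ~~ (d (c j + 1) <= j)%R by apply/negP => /c_mono; rewrite cd; lia.
  by have <- : d (c j + 1) = j + 1 by lia.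
have cE j : c j = j + c 0.
  elim/int_rect: j => [|n IH|n IH]; first by rewrite add0r.
    by rewrite -addn1 PoszD cS IH; lia.
  have := cS (- n.+1%:Z); rewrite (_ : - n.+1%:Z + 1 = - n%:Z) ?IH; lia.
exists (c 0); split; apply: lat_shifts => j v vj.
  by rewrite -cE; case: (cP j v) => + _; apply.
have -> : j - c 0 = d j by rewrite -{1}[j]cd cE addrK.
by case: (dP j v) => + _; apply.
Qed.

(** * Counting the jumps of the chain *)

(** Rank-nullity over the base field [K]: the spaces of columns have dimensions [k1] and [k2] times
    that of [F], which is positive. *)
Lemma mx_kernel_neq0 (k1 k2 : nat) (x : 'M[F]_(k1, k2)) : (k1 < k2)%N ->
  exists2 v : 'cV[F]_k2, v != 0 & x *m v = 0.
Proof.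
move=> k12.
pose f (v : {ffun 'I_k2 -> F}) : {ffun 'I_k1 -> F} := [ffun i => \sum_k x i k * v k].
have f_lin : linear f.
  move=> k u v; apply/ffunP => i; rewrite !ffunE scaler_sumr -big_split /=.
  by apply: eq_bigr => j _; rewrite !ffunE mulrDr scalerAr.
pose fL := GRing.isLinear.Build _ _ _ _ f f_lin.
pose g : {linear {ffun 'I_k2 -> F} -> {ffun 'I_k1 -> F}} := HB.pack f fL.
have kerN0 : lker (linfun g) != 0%VS.
  apply: contraL k12 => /eqP ker0; rewrite -leqNgt.
  have := limg_ker_dim (linfun g) fullv; rewrite ker0 capv0 dimv0 add0n => dimE.
  have := dimvS (subvf (limg (linfun g))); rewrite dimE !dimvf.
  rewrite /dim /= !card_ord leq_pmul2r // -[X in (0 < X)%N](dimvf F) lt0n dimv_eq0.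
  by apply/negP => /eqP F0; have := memvf (1 : F); rewrite F0 memv0 oner_eq0.
have [v vker v0] : exists2 v, v \in lker (linfun g) & v != 0.
  by exists (vpick (lker (linfun g))); rewrite ?memv_pick ?vpick0.
exists (\col_k v k).
  apply: contraNneq v0 => /colP v0; apply/eqP/ffunP => k.
  by have := v0 k; rewrite !mxE ffunE.
apply/colP => i; move: vker; rewrite memv_ker lfunE /= => /eqP/ffunP/(_ i).
by rewrite !ffunE !mxE => vi; rewrite -[RHS]vi; apply: eq_bigr => k _; rewrite mxE.
Qed.

(* The lattices at [j] and [j + 1] differ exactly at the indices in [jump j]. *)
Definition jump (j : int) : {set 'I_N} := [set a | (r%:Z %| j - (blk a)%:Z)%Z].

Lemma jump_mod i j : (r%:Z %| i - j)%Z -> jump i = jump j.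
Proof.
move=> ij; apply/setP => a; by rewrite !inE -[i](subrK j) -addrA rpredDl.
Qed.

(** [lev] increases from [j] to [j + 1] at [a] only if [j = lev j a * r + blk a], that is, on
    [jump j]. *)
Lemma lat_jump j v : lat j v -> (forall a, a \in jump j -> v a 0 = 0) -> lat (j + 1) v.
Proof.
move=> vj v0 a; have [/v0 ->|aj] := boolP (a \in jump j); first exact: fil0.
suff -> : lev (j + 1) a = lev j a by [].
apply: le_anti; apply/andP; split; last by apply: lev_mono; lia.
rewrite lev_le.
have := lev_self j a; rewrite le_eqVlt => /orP[/eqP jE|]; last by lia.
by case/negP: aj; rewrite inE {1}jE addrK dvdz_mull.
Qed.

(* Otherwise some nonzero [v] supported on [jump j] has [x v] vanishing on
   [jump (j + c)], so that [v] in [L_i] implies [x v] in [L_(i + c + 1)] and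
   [v] in [L_(i + 1)], for all [i]. *)
Lemma jump_card_le c (x y : 'M[F]_N) j : y *m x = 1%:M -> shifts c x -> shifts (- c) y ->
  (#|jump j| <= #|jump (j + c)|)%N.
Proof.
move=> yx1 xc yc; rewrite leqNgt; apply/negP => ltc.
(* [P] extends columns indexed by [jump j] by zero. Vanishing of [x v] on the smaller set
   [jump (j + c)] imposes fewer equations than there are unknowns. *)
pose E k := enum_val (A := jump j) k.
pose P : 'M[F]_(N, #|jump j|) := \matrix_(a, k) (a == E k)%:R.
have [u u0 Pu] := mx_kernel_neq0 (rowsub (enum_val (A := jump (j + c))) (x *m P)) ltc.
pose v := P *m u.
have vE k : v (E k) 0 = u k 0.
  rewrite mxE (bigD1 k) //= mxE eqxx mul1r big1 ?addr0 // => k' k'k.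
  by rewrite mxE (inj_eq enum_val_inj) eq_sym (negPf k'k) mul0r.
have v_supp a : a \notin jump j -> v a 0 = 0.
  move=> aj; rewrite mxE big1 // => k _; rewrite mxE.
  case: eqP => [aE|]; last by rewrite mul0r.
  by rewrite aE enum_valP in aj.
have xv0 a : a \in jump (j + c) -> (x *m v) a 0 = 0.
  move=> aj; have /colP/(_ (enum_rank_in aj a)) := Pu.
  rewrite rowsubE -2!mulmxA -rowsubE -/v [RHS]mxE => <-.
  by rewrite [RHS]mxE enum_rankK_in.
(* If [i] and [j] differ modulo [r], the support of [v] misses [jump i]; otherwise [x v] vanishes on
   [jump (i + c)], gains a step, and [y] brings it back. *)
have v_step i : lat i v -> lat (i + 1) v.
  move=> vi; have [ij|ij] := boolP (r%:Z %| i - j)%Z; last first.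
    apply: lat_jump => // a ai; apply: v_supp; apply: contra ij.
    rewrite !inE in ai * => aj; rewrite (_ : i - j = i - (blk a)%:Z - (j - (blk a)%:Z)).
      by rewrite rpredB.
    by lia.
  rewrite (_ : v = y *m (x *m v)); last by rewrite mulmxA yx1 mul1mx.
  rewrite (_ : i + 1 = i + c + 1 + - c); last by lia.
  apply: shifts_lat => //; apply: lat_jump; first exact: shifts_lat.
  move=> a ai; apply: xv0; rewrite (@jump_mod _ (i + c)) // -rpredN.
  by rewrite (_ : - (j + c - (i + c)) = i - j) //; lia.
have [i0 vi0] : exists i, lat i v.
  have [n vn] := fil_bound (fun a => v a 0); exists (n * r%:Z) => a.
  by apply: fil_le (vn a); rewrite lev_le lerDl.
have vi (k : nat) : lat (i0 + k%:Z) v.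
  elim: k => [|k IH]; first by rewrite addr0.
  by rewrite -addn1 PoszD addrA; apply: v_step.
have [a va] : exists a, v a 0 != 0.
  apply: contrapT => v0; case/eqP: u0; apply/colP => k; rewrite mxE -vE.
  by apply/eqP; apply: contrapT => vk; apply: v0; exists (E k); apply/negP.
have [n [_ nmax _]] := fil_exact va.
(* A nonzero entry of valuation [n] excludes [v] from every lattice of index above [m]. *)
pose m := n * r%:Z + (blk a)%:Z.
have := nmax _ (vi (absz (m + 1 - i0)%R) a); rewrite lev_le -/m; lia.
Qed.

Lemma jump_card c (x y : 'M[F]_N) j : x *m y = 1%:M -> y *m x = 1%:M ->
  shifts c x -> shifts (- c) y -> #|jump (j + c)| = #|jump j|.
Proof.
move=> xy1 yx1 xc yc; apply/eqP; rewrite eqn_leq (jump_card_le _ yx1 xc yc) andbT.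
rewrite -{2}[j](addrK c); apply: (jump_card_le _ xy1 yc).
by rewrite opprK.
Qed.

Lemma mem_jump (i : nat) a : (i < r)%N -> (a \in jump i%:Z) = (blk a == i).
Proof.
move=> ir; rewrite inE; apply/idP/eqP => [|->]; last by rewrite subrr dvdz0.
have ar := blk_lt a; rewrite dvdzE; case: (ltngtP (blk a) i) => // ai.
  by move/dvdn_leq; lia.
by move/dvdn_leq; lia.
Qed.

(** * Monomial matrices translating the chain *)

Section Monomial.

Variables (t : nat) (s : 'I_N -> 'I_N) (k : 'I_N -> int).
Hypotheses (s_inj : injective s)
  (s_blk : forall b, (blk (s b))%:Z + k b * r%:Z = (blk b)%:Z + t%:Z).

(** Abstract form of [rho]: [s] permutes the coordinates and [k] records where a factor [w] is
    picked up. *)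
Definition monomial_mx : 'M[F]_N := \matrix_(a, b) (if a == s b then w ^ k b else 0).

Definition monomial_inv : 'M[F]_N := \matrix_(b, a) (if a == s b then w ^ (- k b) else 0).

Lemma monomial_mulV : monomial_mx *m monomial_inv = 1%:M.
Proof.
apply/matrixP => a a'; rewrite !mxE.
have [b ->] : exists b, a = s b by exists (invF s_inj a); rewrite f_invF.
rewrite (bigD1 b) //= !mxE eqxx big1 ?addr0 => [|b' /negPf b'b].
  case: eqP => [->|/eqP/negPf]; first by rewrite -wD subrr eqxx.
  by rewrite eq_sym mulr0 => ->.
by rewrite mxE (inj_eq s_inj) eq_sym b'b mul0r.
Qed.

Lemma monomial_Vmul : monomial_inv *m monomial_mx = 1%:M.
Proof.
apply/matrixP => b b'; rewrite !mxE (bigD1 (s b)) //= big1 ?addr0 => [|a /negPf ab].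
  rewrite !mxE eqxx (inj_eq s_inj); case: eqP => [->|_]; last by rewrite mulr0.
  by rewrite -wD addNr.
by rewrite mxE ab mul0r.
Qed.

Lemma lev_monomial j b : lev (j + t%:Z) (s b) = lev j b + k b.
Proof.
rewrite -lev_shift /lev; congr (- (_ %/ _)%Z).
by have := s_blk b; lia.
Qed.

Lemma monomial_shifts : shifts t%:Z monomial_mx.
Proof.
move=> j a b; rewrite mxE; case: eqP => [->|_]; last exact: fil0.
by rewrite lev_monomial addrAC subrr add0r; apply: filX.
Qed.

Lemma monomial_inv_shifts : shifts (- t%:Z) monomial_inv.
Proof.
move=> j b a; rewrite mxE; case: eqP => [->|_]; last exact: fil0.
rewrite -{2}[j](subrK t%:Z) lev_monomial opprD addrA subrr add0r.
exact: filX.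
Qed.

Lemma monomial_expV (n : nat) : monomial_mx ^+ n *m monomial_inv ^+ n = 1%:M.
Proof.
elim: n => [|n IH]; first by rewrite !expr0 mul1mx.
rewrite exprSr exprS -!mulmxE mulmxA -(mulmxA _ monomial_mx) monomial_mulV.
by rewrite mulmx1.
Qed.

Lemma monomial_Vexp (n : nat) : monomial_inv ^+ n *m monomial_mx ^+ n = 1%:M.
Proof.
elim: n => [|n IH]; first by rewrite !expr0 mul1mx.
rewrite exprSr exprS -!mulmxE mulmxA -(mulmxA _ monomial_inv) monomial_Vmul.
by rewrite mulmx1.
Qed.

Lemma shifts_exp c (x : 'M[F]_N) (n : nat) : shifts c x -> shifts (n%:Z * c) (x ^+ n).
Proof.
move=> xc; elim: n => [|n IH]; first by rewrite expr0 mul0r; apply: shifts1.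
rewrite exprS -mulmxE intS mulrDl mul1r addrC; exact: shiftsM.
Qed.

(** If [x] moves the chain by [c], then [c = q t], and dividing [q] by [l] gives [c = e r + n t]. So
    [x'] also moves it by [c], and [x' y] and [x y'] preserve it. *)
Lemma normalizer_monomial l (x y : 'M[F]_N) : r = (l * t)%N -> (0 < l)%N ->
    (forall c, (forall j, #|jump (j + c)| = #|jump j|) -> (t%:Z %| c)%Z) ->
    x *m y = 1%:M -> y *m x = 1%:M ->
    (forall h, shifts 0 h -> shifts 0 (y *m h *m x)) ->
    (forall h, shifts 0 h -> shifts 0 (x *m h *m y)) ->
  exists (e : int) (n : nat), (n < l)%N /\ exists y' : 'M[F]_N,
    let x' := (w ^ e)%:M *m monomial_mx ^+ n in
    [/\ x' *m y' = 1%:M, y' *m x' = 1%:M,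
        forall h, shifts 0 h -> shifts 0 (x' *m h *m y'),
        forall h, shifts 0 h -> shifts 0 (y' *m h *m x')
      & shifts 0 (x' *m y) /\ shifts 0 (x *m y')].
Proof.
move=> rE l0 tper xy1 yx1 normx normy.
have [c [xc yc]] := normalizer_shifts xy1 yx1 normx normy.
have /tper/dvdzP[q cE] : forall j, #|jump (j + c)| = #|jump j|.
  by move=> j; apply: jump_card xy1 yx1 xc yc.
have lN0 : l%:Z != 0 by lia.
pose e := (q %/ l%:Z)%Z; pose n := absz (q %% l%:Z)%Z.
have nE : n%:Z = (q %% l%:Z)%Z by rewrite gez0_abs // modz_ge0.
have qE : q = e * l%:Z + n%:Z by rewrite nE -divz_eq.
exists e, n; split; first by have := ltz_pmod q (_ : (0 < l%:Z)%R); lia.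
exists (monomial_inv ^+ n *m (w ^ (- e))%:M) => x'.
set y' := monomial_inv ^+ n *m (w ^ (- e))%:M.
have cE' : c = n%:Z * t%:Z + e * r%:Z by rewrite cE qE rE PoszM; ring.
have xc' : shifts c x'.
  by rewrite cE'; apply: shiftsM; [apply: shifts_scalar | apply: shifts_exp monomial_shifts].
have yc' : shifts (- c) y'.
  rewrite (_ : - c = (- e) * r%:Z + n%:Z * (- t%:Z)); last by rewrite cE'; ring.
  by apply: shiftsM; [apply: shifts_exp monomial_inv_shifts | apply: shifts_scalar].
split.
- rewrite /x' /y' mulmxA -(mulmxA (w ^ e)%:M) monomial_expV mulmx1.
  by rewrite -scalar_mxM -wD subrr.
- rewrite /x' /y' mulmxA -(mulmxA _ _ (w ^ e)%:M) -scalar_mxM -wD addNr.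
  by rewrite mulmx1 monomial_Vexp.
- move=> h h0; rewrite -(addNr c); apply: shiftsM => //; rewrite -[c]add0r; exact: shiftsM.
- move=> h h0; rewrite -(subrr c); apply: shiftsM => //; rewrite -[- c]add0r; exact: shiftsM.
- by split; [rewrite -(addNr c) | rewrite -(addNr c)]; apply: shiftsM.
Qed.

End Monomial.

End Valuation.

(** * Periods of the block sizes and the matrix rho *)

Lemma eqn_divmod (q m n : nat) : (m == n) = (m %% q == n %% q)%N && (m %/ q == n %/ q)%N.
Proof.
apply/eqP/andP => [->|[/eqP mn /eqP mn']] //.
by rewrite (divn_eq m q) (divn_eq n q) mn mn'.
Qed.

(** Each column [b] has one nonzero entry, [q] rows further down; in the last block column it wraps
    to the top and becomes [w]. *)
Lemma rho_entry (F : nzRingType) (w : F) (l q a b : nat) : (0 < q)%N ->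
    (a < l * q)%N -> (b < l * q)%N ->
  (if (a %% q == b %% q)%N then rho_coef w l (a %/ q) (b %/ q) else 0) =
  if a == (if b + q < l * q then b + q else b + q - l * q)%N
  then (if (b + q < l * q)%N then 1 else w) else 0.
Proof.
move=> q0 aN bN; have al : (a %/ q < l)%N by rewrite ltn_divLR.
have bl : (b %/ q < l)%N by rewrite ltn_divLR.
have bqE : ((b + q) %/ q = (b %/ q).+1)%N by rewrite divnDr // divnn q0 addn1.
rewrite /rho_coef; case: (ltnP (b + q) (l * q)) => bq.
  have bl1 : ((b %/ q).+1 < l)%N by rewrite -bqE ltn_divLR.
  rewrite (eqn_divmod q a) modnDr bqE; case: eqP => //= _; case: eqP => //= _.
  by rewrite (_ : (b %/ q == l.-1)%N = false) ?andbF //; lia.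
have bl1 : (b %/ q).+1 = l by apply/eqP; rewrite eqn_leq bl -bqE leq_divRL.
have -> : (b + q - l * q = b %% q)%N.
  by rewrite -bl1 mulSn addnC subnDl {1}(divn_eq b q) addKn.
rewrite (eqn_divmod q a) modn_mod (divn_small (ltn_pmod b q0)).
case: eqP => //= _; rewrite bl1 -bl1 eqxx andbT bl1.
by rewrite (_ : (a %/ q == l)%N = false) //; lia.
Qed.

(** * Periods of the sequence of block sizes *)

Section Period.

Variables (r : nat) (p : 'I_r -> nat).
Hypothesis r_gt0 : (0 < r)%N.

(* The [r]-periodic extension of [p] to the integers; [insub] never fails since
   [0 <= z %% r < r]. *)
Definition periodic_ext (z : int) : nat := oapp p 0%N (insub (absz (z %% r%:Z)%Z)).

Local Notation pe := periodic_ext.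

Lemma periodic_ext_ord (i : 'I_r) : pe i%:Z = p i.
Proof. by rewrite /pe modz_small ?ltz_nat //= valK. Qed.

Lemma periodic_ext_mod z z' : (r%:Z %| z - z')%Z -> pe z = pe z'.
Proof. by rewrite -eqz_mod_dvd /pe => /eqP ->. Qed.

Lemma periodic_ext_repr z : exists i : 'I_r, (r%:Z %| z - i%:Z)%Z.
Proof.
have r0 : r%:Z != 0 by lia.
have zr : (absz (z %% r%:Z)%Z < r)%N.
  by have := ltz_pmod z (_ : (0 < r%:Z)%R); have := modz_ge0 z r0; lia.
exists (Ordinal zr); rewrite /= gez0_abs ?modz_ge0 //.
by rewrite {1}(divz_eq z r%:Z) addrK dvdz_mull.
Qed.

Lemma period_ext t : is_period p t -> forall z, pe (z + t%:Z) = pe z.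
Proof.
move=> [_ /dvdnP[l rE] pt] z.
have [[i iP] [j jP]] := (periodic_ext_repr (z + t%:Z), periodic_ext_repr z).
rewrite (periodic_ext_mod iP) (periodic_ext_mod jP) !periodic_ext_ord; apply: pt.
have [/dvdzP[m mE] /dvdzP[n nE]] := (iP, jP).
have ij : i%:Z - j%:Z = (1 + (n - m) * l%:Z) * t%:Z.
  rewrite (_ : i%:Z - j%:Z = z - j%:Z - (z + t%:Z - i%:Z) + t%:Z); last by lia.
  have rZ : r%:Z = l%:Z * t%:Z by rewrite -PoszM -rE.
  by rewrite mE nE rZ; ring.
have : (t%:Z %| i%:Z - j%:Z)%Z by rewrite ij dvdz_mull.
by rewrite -eqz_mod_dvd !modz_nat eqz_nat => /eqP.
Qed.

Lemma ext_period g : (0 < g)%N -> (g %| r)%N -> (forall z, pe (z + g%:Z) = pe z) ->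
  is_period p g.
Proof.
move=> g0 gr pg; split=> [||i j ij]; [by rewrite g0 dvdn_leq | by [] | ].
have pgn (n : nat) z : pe (z + (n * g)%N%:Z) = pe z.
  elim: n => [|n IH]; first by rewrite mul0n addr0.
  by rewrite mulSn PoszD [g%:Z + _]addrC addrA pg.
rewrite -!periodic_ext_ord (divn_eq i g) (divn_eq j g) ij !PoszD.
by rewrite ![(_ * g)%N%:Z + _]addrC !pgn.
Qed.

Lemma shift_mull (d m : int) : (forall z, pe (z + d) = pe z) ->
  forall z, pe (z + m * d) = pe z.
Proof.
move=> pd; elim/int_rect: m => [|n IH|n IH] z; first by rewrite mul0r addr0.
  by rewrite intS mulrDl mul1r addrA IH.
by rewrite -[in RHS](subrK d z) pd intS opprD mulrDl mulN1r addrA IH.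
Qed.

(** By Bezout the gcd of [t] and [c] is again a period, and it divides [r]; minimality makes it
    equal to [t]. *)
Lemma minimal_period_dvd t c : minimal_period p t -> (forall z, pe (z + c) = pe z) ->
  (t%:Z %| c)%Z.
Proof.
move=> [pt tmin] pc; have [/andP[t0 tr] tdvd _] := pt.
pose g := gcdn t (absz c).
have pg : is_period p g.
  apply: ext_period.
  - by rewrite gcdn_gt0 t0.
  - exact: dvdn_trans (dvdn_gcdl _ _) tdvd.
  - have [u [v uv]] := Bezoutz t%:Z c => z.
    have -> : g%:Z = u * t%:Z + v * c by rewrite uv.
    by rewrite addrA (shift_mull v pc) (shift_mull u (period_ext pt)).
have gE : g = t by apply/eqP; rewrite eqn_leq tmin // dvdn_leq // dvdn_gcdl.
by rewrite dvdzE -gE dvdn_gcdr.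
Qed.

(** * Positions of the blocks *)

(** The first row of block [n]. The periodic extension lets [n] exceed [r], so that blocks can be
    followed past the wrap. *)
Definition offset (n : nat) : nat := \sum_(k < n) pe k%:Z.

Lemma offset_ord n : (n <= r)%N -> offset n = \sum_(i < r | (i < n)%N) p i.
Proof.
move=> nr; rewrite /offset (big_ord_widen _ (fun k : nat => pe k%:Z) nr).
by apply: eq_bigr => i _; rewrite periodic_ext_ord.
Qed.

Lemma offset_total : offset r = \sum_i p i.
Proof. by rewrite offset_ord //; apply: eq_bigl => i; rewrite ltn_ord. Qed.

Lemma offset_le m n : (m <= n)%N -> (offset m <= offset n)%N.
Proof.
by move=> /subnKC <-; rewrite /offset big_split_ord leq_addr.
Qed.

Lemma offsetD (d n : nat) : (forall z, pe (z + d%:Z) = pe z) ->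
  offset (d + n) = (offset d + offset n)%N.
Proof.
move=> pd; rewrite /offset big_split_ord; congr (_ + _)%N.
by apply: eq_bigr => k _; rewrite /= PoszD addrC pd.
Qed.

Lemma offsetM (d n : nat) : (forall z, pe (z + d%:Z) = pe z) ->
  offset (n * d) = (n * offset d)%N.
Proof.
move=> pd; elim: n => [|n IH]; first by rewrite /offset big_ord0.
by rewrite mulSn offsetD // IH mulSn.
Qed.

Lemma periodic_extS z : pe (z + r%:Z) = pe z.
Proof. by apply: periodic_ext_mod; rewrite addrAC subrr add0r dvdzz. Qed.

Lemma sig1_offset (a : 'I_(\sum_i p i)) :
  (offset (tagnat.sig1 a) <= a < offset (tagnat.sig1 a).+1)%N.
Proof.
have := tagnat.rect a; set i := tagnat.sig1 a => aE.
rewrite {2}/offset big_ord_recr /= -/(offset i) periodic_ext_ord.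
by rewrite offset_ord ?(ltnW (ltn_ord i)) // {1 2}aE leq_addr ltn_add2l ltn_ord.
Qed.

Lemma sig1_unique (a : 'I_(\sum_i p i)) n : (offset n <= a < offset n.+1)%N ->
  tagnat.sig1 a = n :> nat.
Proof.
move=> /andP[na an]; have /andP[ia ai] := sig1_offset a.
case: (ltngtP (tagnat.sig1 a) n) => // /offset_le le_off.
  by move: (leq_trans ai le_off); rewrite ltnNge na.
by move: (leq_trans an le_off); rewrite ltnNge ia.
Qed.

(** * The coordinate permutation underlying [rho] *)

Section Rotation.

Variable t : nat.
Hypothesis pt : is_period p t.
Local Notation N := (\sum_i p i).
Local Notation q := (offset t).

Lemma offset_size : N = (r %/ t * q)%N.
Proof.
have [_ tr _] := pt.
by rewrite -offset_total -{1}(divnK tr) offsetM //; apply: period_ext.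
Qed.

Lemma rotate_subproof (b : 'I_N) : ((b + q) %% N < N)%N.
Proof. by rewrite ltn_mod; case: (N) b => // -[]. Qed.

Definition rotate (b : 'I_N) : 'I_N := Ordinal (rotate_subproof b).

(* [rotate] followed by scaling by [w ^ rotate_carry] is the action of [rho] on
   the standard basis. *)
Definition rotate_carry (b : 'I_N) : int := if (b + q < N)%N then 0 else 1.

Lemma offset_le_size : (q <= N)%N.
Proof. by rewrite -offset_total offset_le //; case: pt => /andP[]. Qed.

Lemma rotateE b : rotate b = (if (b + q < N) then b + q else b + q - N)%N :> nat.
Proof.
rewrite /=; case: ltnP => Nb; first by rewrite modn_small.
rewrite -{1}(subnK Nb) modnDr modn_small // ltn_subLR //.
exact: leq_add (ltn_ord b) offset_le_size.
Qed.

Lemma rotate_inj : injective rotate.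
Proof.
have shift_inj (n n' M d : nat) : (n < M)%N -> (n' < M)%N -> (d <= M)%N ->
    (if n + d < M then n + d else n + d - M)%N
      = (if n' + d < M then n' + d else n' + d - M)%N -> n = n'.
  by case: (ltnP (n + d) M); case: (ltnP (n' + d) M); lia.
move=> b b' /(congr1 (@nat_of_ord N)); rewrite !rotateE => bb'; apply: val_inj.
exact: shift_inj (ltn_ord b) (ltn_ord b') offset_le_size bb'.
Qed.

(** Since [offset (t + i) = q + offset i], adding [q] moves block [i] to block [t + i]; wrapping
    past [N] lowers the block index by [r], which the carry records. *)
Lemma rotate_sig1 b :
  (tagnat.sig1 (rotate b))%:Z + rotate_carry b * r%:Z = (tagnat.sig1 b)%:Z + t%:Z.
Proof.
have /andP[ib bi] := sig1_offset b; set i := tagnat.sig1 b in ib bi *.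
have pt' := period_ext pt.
have [/andP[t0 tr] _ _] := pt.
have qi : offset (t + i) = (q + offset i)%N by apply: offsetD.
have qi1 : offset (t + i).+1 = (q + offset i.+1)%N by rewrite -addnS; apply: offsetD.
have Ni n : offset (r + n) = (N + offset n)%N.
  by rewrite offsetD ?offset_total //; apply: periodic_extS.
have := rotateE b; rewrite /rotate_carry; case: ltnP => Nb rb.
  rewrite mul0r addr0 -PoszD; congr Posz; rewrite addnC; apply: sig1_unique.
  by rewrite rb qi qi1 [(b + q)%N]addnC leq_add2l ltn_add2l ib.
have ir : (r <= t + i)%N.
  rewrite leqNgt; apply/negP => /offset_le; rewrite offset_total qi1 leqNgt => /negP[].
  by apply: leq_ltn_trans Nb _; rewrite addnC ltn_add2l.
have irE : (t + i)%N = (r + (t + i - r))%N by rewrite subnKC.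
rewrite irE -?addnS in qi qi1; rewrite !Ni in qi qi1.
have -> : tagnat.sig1 (rotate b) = (t + i - r)%N :> nat.
  apply: sig1_unique; rewrite rb -(leq_add2l N) -(ltn_add2l N) qi qi1 subnKC //.
  by rewrite [(b + q)%N]addnC leq_add2l ltn_add2l ib.
by rewrite mul1r; lia.
Qed.

Lemma rho_rotate (F : nzRingType) (w : F) (a b : 'I_N) : (0 < q)%N ->
  rho w (r %/ t) q N a b =
  if a == rotate b then (if (b + q < N)%N then 1 else w) else 0.
Proof.
move=> q0; have NE := offset_size.
have aN : (a < r %/ t * q)%N := leq_trans (ltn_ord a) (eq_leq NE).
have bN : (b < r %/ t * q)%N := leq_trans (ltn_ord b) (eq_leq NE).
have ltE := congr1 (fun n => (b + q < n)%N) NE.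
have sE := rotateE b.
have := rho_entry w q0 aN bN.
have subE := congr1 (fun n => (b + q - n)%N) NE.
rewrite -[(b + q < _ * _)%N]ltE -[(b + q - _)%N]subE -sE mxE => ->.
by [].
Qed.

End Rotation.
End Period.

Lemma card_sig1 (r : nat) (p : 'I_r -> nat) (i : 'I_r) (A : {set 'I_(\sum_i p i)}) :
  (forall a, (a \in A) = (tagnat.sig1 a == i)) -> #|A| = p i.
Proof.
move=> AE; have -> : A = [set tagnat.Rank i j | j in [set: 'I_(p i)]]%SET.
  apply/setP => a; rewrite AE; apply/eqP/imsetP => [ai|[j _ ->]]; last exact: tagnat.Rank1K.
  by rewrite -(tagnat.sig2K a); case: _ / ai; exists (tagnat.sig2 a).
rewrite card_imset ?cardsT ?card_ord // => j j' /(congr1 val)/eqP.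
by rewrite tagnat.eq_Rank eqxx => /eqP/val_inj.
Qed.

(** * Normalizer elements up to units of the hereditary order *)

Theorem theorem3p7 (R : idomainType) (hR : complete_dvr R)
  (F : falgType {fraction R}) (hF : skew_field F)
  (hcenter : ('Z({: F}) = 1)%VS)
  (O : set F) (hO : maximal_order O)
  (w : F) (hw : jacobson_radical O w)
  (hwO : jacobson_radical O = lmul_set w O)
  (hOw : jacobson_radical O = rmul_set O w)
  (r : nat) (p : 'I_r -> nat) (hp : forall i, (0 < p i)%N)
  (t : nat) (ht : minimal_period p t)
  (x : 'M[F]_(\sum_i p i))
  (hx : normalizer (standard_hereditary_order O p) x) :
  exists (d : int) (k : nat),
    (k < r %/ t)%N /\
    normalizer_equiv (standard_hereditary_order O p) x
      ((w ^ (- d))%:M *m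
       rho w (r %/ t) (period_sum p t) (\sum_i p i) ^+ k).
Proof.
have [dvrR complR] := hR; have [ordO _] := hO.
have [pi [unifpi pi0 piN pi_local]] := dvr_uniformizer dvrR.
have pi_sep b := @dvr_separated R pi b dvrR pi0 piN.
have pi_compl := complR pi unifpi.
have [pt tmin] := ht; have [/andP[t0 tr] tdvd _] := pt.
have r0 : (0 < r)%N := leq_trans t0 tr.
pose blk (a : 'I_(\sum_i p i)) : nat := tagnat.sig1 a.
have blk_lt a : (blk a < r)%N by apply: ltn_ord.
have blk_surj i : (i < r)%N -> exists a, blk a = i.
  move=> ir; exists (tagnat.Rank (Ordinal ir) (Ordinal (hp (Ordinal ir)))).
  by rewrite /blk tagnat.Rank1K.
have Ow : O w := prime_order hw.
have Uw : w \is a GRing.unit := prime_unit hF ordO pi0 piN pi_local pi_sep pi_compl hwO.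
have Oconj := prime_conj hF ordO pi0 piN pi_local pi_sep pi_compl hwO hOw.
have OV := prime_order_unit hF ordO pi0 piN pi_local pi_sep pi_compl hwO.
have Oval := prime_valuation hF ordO pi0 piN pi_local pi_sep pi_compl hw hwO.
have radP := prime_radicalP hF ordO pi0 piN pi_local pi_sep pi_compl hwO.
have O1 := order1 ordO; have OM := orderM ordO; have OB := orderB ordO.
have shifts0 := shifts0P O1 OM Ow Uw Oconj r0 blk_lt.
(* The hereditary order is the stabilizer of the lattice chain. *)
have HE h : standard_hereditary_order O p h <-> shifts O w r blk 0 h.
  apply: iff_trans (iff_sym (shifts0 h)).
  split=> [Hh a b|Hh i j a b].
    have := Hh _ _ (tagnat.sig2 a) (tagnat.sig2 b).
    rewrite mxE !tagnat.sig2K /blk leqNgt.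
    by case: ltnP => _ /=; [move/radP | move=> Hab; apply/fil_ring].
  have := Hh (tagnat.Rank i a) (tagnat.Rank j b).
  rewrite /blk !tagnat.Rank1K mxE [(j <= i)%N]leqNgt.
  by case: ltnP => _ /=; [move=> Hab; apply/radP | move/fil_ring].
have [y [xy1 yx1 normx]] := hx.
have normxy h : shifts O w r blk 0 h -> shifts O w r blk 0 (x *m h *m y).
  by move=> /HE Hh; apply/HE; rewrite -normx; exists h.
have normyx h : shifts O w r blk 0 h -> shifts O w r blk 0 (y *m h *m x).
  move=> /HE; rewrite -{1}normx => -[h' Hh' <-]; apply/HE.
  by rewrite !mulmxA yx1 mul1mx -mulmxA yx1 mulmx1.
have q0 : (0 < offset p t)%N.
  rewrite /offset (bigD1 (Ordinal t0)) //= ltn_addr //.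
  by rewrite (periodic_ext_ord p (Ordinal r0)) hp.
have rotate_blk b : (blk (rotate t b))%:Z + rotate_carry t b * r%:Z = (blk b)%:Z + t%:Z.
  exact: rotate_sig1.
have tper c : (forall j, #|jump r blk (j + c)| = #|jump r blk j|) -> (t%:Z %| c)%Z.
  move=> jumpc; apply: (minimal_period_dvd r0 ht) => z.
  (* The jump at [j] consists of the coordinates of the block [j] modulo [r], so its cardinality is
     that block size. *)
  have jumpE j : #|jump r blk j| = periodic_ext p j.
    have [i ij] := periodic_ext_repr r0 j.
    rewrite (jump_mod blk ij) (periodic_ext_mod p ij) periodic_ext_ord.
    by apply: card_sig1 => a; rewrite (mem_jump Uw r0 blk_lt).
  by rewrite -!jumpE jumpc.
have [e [k [kl [y' [xy1' yx1' normxy' normyx' [gx gy]]]]]] :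
  exists (e : int) (n : nat), (n < r %/ t)%N /\ exists y',
    let x' := (w ^ e)%:M *m monomial_mx w (rotate t) (rotate_carry t) ^+ n in
    [/\ x' *m y' = 1%:M, y' *m x' = 1%:M,
        forall h, shifts O w r blk 0 h -> shifts O w r blk 0 (x' *m h *m y'),
        forall h, shifts O w r blk 0 h -> shifts O w r blk 0 (y' *m h *m x')
      & shifts O w r blk 0 (x' *m y) /\ shifts O w r blk 0 (x *m y')].
  apply: normalizer_monomial => //.
  - exact: rotate_inj.
  - by rewrite divnK.
  - by rewrite divn_gt0.
have rhoE : rho w (r %/ t) (period_sum p t) (\sum_i p i)
    = monomial_mx w (rotate t) (rotate_carry t).
  rewrite /period_sum -offset_ord //.
  apply/matrixP => a b; rewrite (rho_rotate r0 pt) // mxE /rotate_carry.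
  by case: ifP => // _; case: ifP.
exists (- e), k; split=> //; rewrite opprK rhoE.
set x' := (w ^ e)%:M *m _ in xy1' yx1' normxy' normyx' gx gy *; clearbody x'.
split=> //.
  exists y'; split=> //; apply/seteqP; split=> [_ [h /HE Hh <-]|h /HE Hh].
    exact/HE/normxy'.
  exists (y' *m h *m x'); first exact/HE/normyx'.
  by rewrite !mulmxA xy1' mul1mx -mulmxA xy1' mulmx1.
(* From [x' = (x' y) x], the left factor is [x' y], a unit with inverse [x y'], and the right one is
   1. *)
exists (x' *m y), 1%:M; split; last by rewrite mulmx1 -mulmxA yx1 mulmx1.
  split; first exact/HE.
  exists (x *m y'); split; first exact/HE.
    by rewrite mulmxA -(mulmxA x') yx1 mulmx1.
  by rewrite mulmxA -(mulmxA x) yx1' mulmx1.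
have H1 : standard_hereditary_order O p 1%:M.
  by apply/HE; exact (shifts1 O1 OB OM Ow Uw Oconj r0 blk_lt).
by split=> //; exists 1%:M; rewrite mulmx1.
Qed.
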